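(* Let $\mathcal B=\mathrm{AC}$ and let $>$ be an AC-compatible reduction order used by both $\mathcal I_A$ and $\mathcal{KB}_{\mathrm{AC}}$. For every fair run $(\mathcal E,\varnothing)\vdash^*_{\mathcal I_A}(\varnothing,\mathcal R)$ there exists a run $(\mathcal E,\varnothing)\vdash^*_{\mathcal{KB}_{\mathrm{AC}}}(\varnothing,\mathcal R')$ such that $\mathcal R'/\mathrm{AC}$ is an AC-complete presentation of $\mathcal E$, i.e. $\mathcal R'$ is terminating modulo AC, $\leftrightarrow^*_{\mathcal E\cup\mathrm{AC}}=\leftrightarrow^*_{\mathcal R'\cup\mathrm{AC}}$, and $\leftrightarrow^*_{\mathcal R'\cup\mathrm{AC}}\subseteq\to^*_{\mathcal R'/\mathrm{AC}}\cdot\sim_{\mathrm{AC}}\cdot\leftarrow^*_{\mathcal R'/\mathrm{AC}}$.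
   Context: Terms over a signature $\mathcal F$ with a set of binary AC symbols; $\mathrm{AC}$ is the ES $\{f(x,y)\approx f(y,x),\ f(f(x,y),z)\approx f(x,f(y,z))\mid f\text{ an AC symbol}\}$. For a set $\mathcal E$ of pairs of terms (equations and rules read as oriented pairs), $s\to_{\mathcal E}t$ iff $s|_p=\ell\sigma$, $t=s[r\sigma]_p$ for some $(\ell,r)\in\mathcal E$, position $p$, substitution $\sigma$; $\leftarrow$ is the inverse, $\leftrightarrow$ the symmetric closure. With $\mathcal B$ a fixed ES satisfying $\mathrm{Var}(\ell)=\mathrm{Var}(r)$ for its equations (here $\mathcal B=\mathrm{AC}$): $\sim_{\mathcal B}=\leftrightarrow^*_{\mathcal B}$, $\mathcal B^\pm=\mathcal B\cup\{t\approx s\mid s\approx t\in\mathcal B\}$, $\to_{\mathcal R/\mathcal B}=\sim_{\mathcal B}\cdot\to_{\mathcal R}\cdot\sim_{\mathcal B}$, $s\downarrow^\sim_{\mathcal R}t$ iff $s\to^*_{\mathcal R}\cdot\sim_{\mathcal B}\cdot\leftarrow^*_{\mathcal R}t$; terminating modulo $\mathcal B$: no infinite $\to_{\mathcal R/\mathcal B}$-sequence. A $\mathcal B$-compatible reduction order is a well-founded order on terms closed under contexts and substitutions with $\sim_{\mathcal B}\cdot>\cdot\sim_{\mathcal B}\subseteq>$. Inference system $\mathcal I_A$ (parameterized by $>$) on pairs $(\mathcal E,\mathcal R)$ ($\uplus$ disjoint union, $s\approx^\pm t$ means $s\approx t$ or $t\approx s$): Deduce (peak): $(\mathcal E,\mathcal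 R)\vdash(\mathcal E\cup\{s\approx t\},\mathcal R)$ if $s\leftarrow_{\mathcal R}\cdot\to_{\mathcal R}t$. Deduce (cliff): $(\mathcal E,\mathcal R)\vdash(\mathcal E,\mathcal R\cup\{t\to s\})$ if $s\leftarrow_{\mathcal R}\cdot\leftrightarrow_{\mathcal B}t$. Orient: $(\mathcal E\uplus\{s\approx^\pm t\},\mathcal R)\vdash(\mathcal E,\mathcal R\cup\{s\to t\})$ if $s>t$. Delete: $(\mathcal E\uplus\{s\approx t\},\mathcal R)\vdash(\mathcal E,\mathcal R)$ if $s\sim_{\mathcal B}t$. Simplify: $(\mathcal E\uplus\{s\approx^\pm t\},\mathcal R)\vdash(\mathcal E\cup\{u\approx t\},\mathcal R)$ if $s\to_{\mathcal R/\mathcal B}u$. Collapse: $(\mathcal E,\mathcal R\uplus\{s\to t\})\vdash(\mathcal E\cup\{u\approx t\},\mathcal R)$ if $s\to_{\mathcal R}u$. Compose: $(\mathcal E,\mathcal R\uplus\{s\to t\})\vdash(\mathcal E,\mathcal R\cup\{s\to u\})$ if $t\to_{\mathcal R/\mathcal B}u$. The inference system $\mathcal{KB}_{\mathrm{AC}}$ is $\mathcal I_A$ with $\mathcal B=\mathrm{AC}$, except that Collapse may rewrite with $\to_{\mathcal R/\mathrm{AC}}$ (condition $s\to_{\mathcal R/\mathrm{AC}}u$), and the two Deduce rules are replaced by: $(\mathcal E,\mathcal R)\vdash(\mathcal E\cup\{s\approx t\},\mathcal R)$ if $s\leftarrow_{\mathcal R}\cdot\sim_{\mathrm{AC}}\cdot\to_{\mathcal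 R}t$. An $\mathcal I_A$-run for $\mathcal E$ goes from $(\mathcal E_0,\mathcal R_0)=(\mathcal E,\varnothing)$ to $(\mathcal E_n,\mathcal R_n)$; it is fair if $\mathcal R_n$ is left-linear, $\mathrm{PCP}(\mathcal R_n)\subseteq\ \downarrow^\sim_{\mathcal R_n}\cup\bigcup_{i=0}^n\leftrightarrow_{\mathcal E_i\cup\mathcal R_i}$ and $\mathrm{PCP}^\pm(\mathcal R_n,\mathcal B^\pm)\subseteq\ \downarrow^\sim_{\mathcal R_n}\cup\bigcup_{i=0}^n\leftrightarrow_{\mathcal R_i}$. Critical pairs: for sets of oriented pairs $\mathcal R_1,\mathcal R_2$, an overlap is $\langle\ell_1\to r_1,p,\ell_2\to r_2\rangle$ with $\ell_i\to r_i$ variants of elements of $\mathcal R_i$ without common variables, $p$ a non-variable position of $\ell_2$, $\ell_1,\ell_2|_p$ unifiable, rules not variants if $p=\epsilon$; with mgu $\sigma$ it yields the critical pair $\ell_2\sigma[r_1\sigma]_p\approx r_2\sigma$, prime if all proper subterms of $\ell_2\sigma|_p$ are normal forms w.r.t. the TRS under consideration. $\mathrm{PCP}(\mathcal R)$: prime critical pairs of $\mathcal R$ with itself; $\mathrm{PCP}^\pm(\mathcal R,\mathcal B^\pm)$: prime critical pairs between $\mathcal R$ and $\mathcal B^\pm$ in either order. *)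

(* Defs.v *)
From Stdlib Require Import List Relations.
Import ListNotations.
Set Implicit Arguments.

Section Terms.
Variable F : Type.

Inductive term : Type :=
| Var : nat -> term
| Fun : F -> list term -> term.

Definition subst := nat -> term.

Fixpoint tsub (sg : subst) (t : term) : term :=
  match t with
  | Var x => sg x
  | Fun f ts => Fun f (map (tsub sg) ts)
  end.

Fixpoint vars (t : term) : list nat :=
  match t with
  | Var x => [x]
  | Fun _ ts => flat_map vars ts
  end.

Inductive ctx : Type :=
| Hole : ctx
| CFun : F -> list term -> ctx -> list term -> ctx.

Fixpoint fill (C : ctx) (t : term) : term :=
  match C with
  | Hole => t
  | CFun f l C' r => Fun f (l ++ fill C' t :: r)
  end.

Fixpoint csub (sg : subst) (C : ctx) : ctx :=
  match C with
  | Hole => Hole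
  | CFun f l C' r => CFun f (map (tsub sg) l) (csub sg C') (map (tsub sg) r)
  end.

Definition trs := (term * term) -> Prop.
Definition empty_trs : trs := fun _ => False.
Definition union (A B : trs) : trs := fun p => A p \/ B p.
Definition inv_trs (A : trs) : trs := fun p => A (snd p, fst p).
Definition pm (A : trs) : trs := union A (inv_trs A).

Definition is_dadd (E0 : trs) (e : term * term) (E : trs) : Prop :=
  ~ E0 e /\ forall p, E p <-> (E0 p \/ p = e).
Definition is_add (E0 : trs) (e : term * term) (E : trs) : Prop :=
  forall p, E p <-> (E0 p \/ p = e).
Definition same (A B : trs) : Prop := forall p, A p <-> B p.

Definition rel := term -> term -> Prop.
Definition comp (r1 r2 : rel) : rel := fun s t => exists u, r1 s u /\ r2 u t.
Definition invr (r : rel) : rel := fun s t => r t s.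
Definition symr (r : rel) : rel := fun s t => r s t \/ r t s.
Definition rt (r : rel) : rel := clos_refl_trans term r.

Definition rstep (R : trs) : rel := fun s t =>
  exists C l r sg, R (l, r) /\ s = fill C (tsub sg l) /\ t = fill C (tsub sg r).

Definition conv (R : trs) : rel := rt (symr (rstep R)).

Definition ACeqs (ac : F -> Prop) : trs := fun p =>
  exists f, ac f /\
   (p = (Fun f [Var 0; Var 1], Fun f [Var 1; Var 0]) \/
    p = (Fun f [Fun f [Var 0; Var 1]; Var 2], Fun f [Var 0; Fun f [Var 1; Var 2]])).

Section Modulo.
Variable B : trs.

Definition simB : rel := rt (symr (rstep B)).
Definition rstep_mod (R : trs) : rel := comp simB (comp (rstep R) simB).
Definition joinable_sim (R : trs) : rel := fun s t =>
  exists u v, rt (rstep R) s u /\ simB u v /\ rt (rstep R) t v.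
Definition terminating_mod (R : trs) : Prop :=
  ~ exists f : nat -> term, forall i, rstep_mod R (f i) (f (S i)).

Definition reduction_order (gt : rel) : Prop :=
  (forall s, ~ gt s s) /\
  (forall s t u, gt s t -> gt t u -> gt s u) /\
  well_founded (invr gt) /\
  (forall C s t, gt s t -> gt (fill C s) (fill C t)) /\
  (forall sg s t, gt s t -> gt (tsub sg s) (tsub sg t)).
Definition B_compatible_reduction_order (gt : rel) : Prop :=
  reduction_order gt /\ (forall s s' t t', simB s s' -> gt s' t' -> simB t' t -> gt s t).

Variable gt : rel.

Definition IA_step (st st' : trs * trs) : Prop :=
  let (E, R) := st in let (E', R') := st' in
  (exists s t, comp (invr (rstep R)) (rstep R) s t /\ is_add E (s, t) E' /\ same R' R) \/
  (exists s t, comp (invr (rstep R)) (symr (rstep B)) s t /\ same E' E /\ is_add R (t, s) R') \/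
  (exists E0 s t, (is_dadd E0 (s, t) E \/ is_dadd E0 (t, s) E) /\ gt s t /\
     same E' E0 /\ is_add R (s, t) R') \/
  (exists E0 s t, is_dadd E0 (s, t) E /\ simB s t /\ same E' E0 /\ same R' R) \/
  (exists E0 s t u, (is_dadd E0 (s, t) E \/ is_dadd E0 (t, s) E) /\ rstep_mod R s u /\
     is_add E0 (u, t) E' /\ same R' R) \/
  (exists R0 s t u, is_dadd R0 (s, t) R /\ rstep R0 s u /\
     is_add E (u, t) E' /\ same R' R0) \/
  (exists R0 s t u, is_dadd R0 (s, t) R /\ rstep_mod R0 t u /\
     same E' E /\ is_add R0 (s, u) R').

End Modulo.

Definition KBAC_step (ac : F -> Prop) (gt : rel) (st st' : trs * trs) : Prop :=
  let B := ACeqs ac in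
  let (E, R) := st in let (E', R') := st' in
  (exists s t, comp (invr (rstep R)) (comp (simB B) (rstep R)) s t /\
     is_add E (s, t) E' /\ same R' R) \/
  (exists E0 s t, (is_dadd E0 (s, t) E \/ is_dadd E0 (t, s) E) /\ gt s t /\
     same E' E0 /\ is_add R (s, t) R') \/
  (exists E0 s t, is_dadd E0 (s, t) E /\ simB B s t /\ same E' E0 /\ same R' R) \/
  (exists E0 s t u, (is_dadd E0 (s, t) E \/ is_dadd E0 (t, s) E) /\ rstep_mod B R s u /\
     is_add E0 (u, t) E' /\ same R' R) \/
  (exists R0 s t u, is_dadd R0 (s, t) R /\ rstep_mod B R0 s u /\
     is_add E (u, t) E' /\ same R' R0) \/
  (exists R0 s t u, is_dadd R0 (s, t) R /\ rstep_mod B R0 t u /\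
     same E' E /\ is_add R0 (s, u) R').

Definition is_run (step : trs * trs -> trs * trs -> Prop) (E : trs) (n : nat)
  (sq : nat -> trs * trs) : Prop :=
  fst (sq 0) = E /\ same (snd (sq 0)) empty_trs /\
  forall i, i < n -> step (sq i) (sq (S i)).

Definition renaming (pi : nat -> nat) : Prop :=
  exists pi', (forall x, pi' (pi x) = x) /\ (forall x, pi (pi' x) = x).
Definition ren_sub (pi : nat -> nat) : subst := fun x => Var (pi x).
Definition variant (p q : term * term) : Prop :=
  exists pi, renaming pi /\ fst p = tsub (ren_sub pi) (fst q) /\
                             snd p = tsub (ren_sub pi) (snd q).
Definition variant_of (R : trs) (p : term * term) : Prop :=
  exists q, R q /\ variant p q.
Definition is_mgu (sg : subst) (s t : term) : Prop :=
  tsub sg s = tsub sg t /\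
  forall tau, tsub tau s = tsub tau t ->
    exists delta, forall x, tau x = tsub delta (sg x).
Definition NF (R : trs) (t : term) : Prop := ~ exists u, rstep R t u.
Definition is_var (t : term) : Prop := exists x, t = Var x.

(* prime critical pairs from overlaps <l1 -> r1, p, l2 -> r2> with l1->r1 from R1,
   l2 -> r2 from R2; primality w.r.t. the TRS Rn *)
Definition PCP2 (R1 R2 Rn : trs) : rel := fun s t =>
  exists l1 r1 l2 r2 C u sg,
    variant_of R1 (l1, r1) /\ variant_of R2 (l2, r2) /\
    (forall x, In x (vars l1 ++ vars r1) -> ~ In x (vars l2 ++ vars r2)) /\
    l2 = fill C u /\ ~ is_var u /\
    (C = Hole -> ~ variant (l1, r1) (l2, r2)) /\
    is_mgu sg l1 u /\
    s = fill (csub sg C) (tsub sg r1) /\ t = tsub sg r2 /\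
    (forall C' v, C' <> Hole -> tsub sg u = fill C' v -> NF Rn v).

Definition PCP (R : trs) : rel := PCP2 R R R.
Definition PCPpm (R B : trs) : rel := fun s t =>
  PCP2 R (pm B) R s t \/ PCP2 (pm B) R R s t.

Definition left_linear (R : trs) : Prop :=
  forall l r, R (l, r) -> NoDup (vars l).

Definition fair_run (B : trs) (n : nat) (sq : nat -> trs * trs) : Prop :=
  let Rn := snd (sq n) in
  left_linear Rn /\
  (forall s t, PCP Rn s t ->
     joinable_sim B Rn s t \/
     exists i, i <= n /\ symr (rstep (union (fst (sq i)) (snd (sq i)))) s t) /\
  (forall s t, PCPpm Rn B s t ->
     joinable_sim B Rn s t \/
     exists i, i <= n /\ symr (rstep (snd (sq i))) s t).

Definition AC_complete_presentation (ac : F -> Prop) (R E : trs) : Prop :=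
  let B := ACeqs ac in
  terminating_mod B R /\
  (forall s t, conv (union E B) s t <-> conv (union R B) s t) /\
  (forall s t, conv (union R B) s t ->
     exists u v, rt (rstep_mod B R) s u /\ simB B u v /\ rt (rstep_mod B R) t v).

End Terms.

(* Main.v *)
(* A fair [I_A] run produces an [R] that is Church-Rosser modulo [B].  Rules and equations of
   every intermediate state persist as [R]-conversions below their larger side.  A local peak, or
   a cliff [a <- u <-> b], which is not prime is split at the result [v] of contracting an
   innermost redex of [u] inside the inner redex; the two resulting diagrams are prime, hence
   closed by fairness.  Well-founded induction on the order then gives unique normal forms up
   to [B].

   The [KB] run uses neither Collapse nor Compose, so its rule set [R'] only grows, and
   [->_R] is contained in [->+_{R'/AC}]: a cliff rule [t -> s] is already an [R'/AC]-step, and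
   equations obtained from peaks can be deduced again whenever they have to be oriented.
   Initial equations cannot be regenerated; they are kept unsimplified until the [I_A] run
   orients a descendant.  Once [R'] contains all that is needed to simulate [R], it is
   AC-complete, so the finitely many remaining equations can be simplified and deleted. *)
Require Import Defs.
From Stdlib Require Import List Relations.
From Stdlib Require Import Classical Lia PeanoNat.
Import ListNotations.

(** A peak may be closed by any conversion below its source [u], but in a cliff the side [b] is
    equivalent to [u] and so not below it. Cliff diagrams therefore have to expose a genuine rule
    step from [b]. This is why fairness closes cliffs only with rules of intermediate states, and
    why rules are shown to persist with an explicit first step while equations persist as mere
    conversions. Linearity matters most here: in a variable overlap, the single occurrence lets one
    side catch up in one step.

    Persistence is proved backwards from the last state, where no equation is left. The simulation
    runs forwards, and its obstacle is that equations form sets: simplifying one may merge it with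
    another, and a merged equation can be oriented only once. An ownership relation between the
    equations of the two runs accounts for such losses. Since each [I_A] step removes at most one
    equation, emptiness of the last set also makes [E] finite, so that the final clean-up ends. *)

Section Development.
Variable F : Type.
Notation term := (term F).
Notation ctx := (ctx F).
Notation trs := (trs F).
Notation subst := (subst F).
Notation Hole := (Hole F).
Notation Var := (Var F).
Implicit Types (s d : subst) (t u v a b : term) (C D : ctx).

(** * Terms, contexts and substitutions *)

Fixpoint term_list_ind (P : term -> Prop) (HV : forall x, P (Var x))
  (HF : forall f ts, Forall P ts -> P (Fun f ts)) (t : term) : P t :=
  match t with
  | Defs.Var _ x => HV x
  | Fun f ts => HF f ts ((fix go l : Forall P l :=
      match l with
      | [] => Forall_nil P
      | u :: l' => Forall_cons u (term_list_ind P HV HF u) (go l')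
      end) ts)
  end.

Fixpoint size (t : term) : nat :=
  match t with
  | Defs.Var _ _ => 1
  | Fun _ ts => S (list_sum (map size ts))
  end.

Fixpoint ccomp (C D : ctx) : ctx :=
  match C with
  | Defs.Hole _ => D
  | CFun f l C' r => CFun f l (ccomp C' D) r
  end.

Lemma tsub_comp (d s : subst) t :
  tsub d (tsub s t) = tsub (fun x => tsub d (s x)) t.
Proof.
  induction t as [x|f ts IH] using term_list_ind; simpl; auto.
  f_equal. rewrite map_map. apply map_ext_in. now apply Forall_forall.
Qed.

Lemma tsub_ext (s s' : subst) t :
  (forall x, In x (vars t) -> s x = s' x) -> tsub s t = tsub s' t.
Proof.
  induction t as [x|f ts IH] using term_list_ind; simpl; intros H; auto.
  f_equal. apply map_ext_in. intros a Ha. rewrite Forall_forall in IH.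
  apply IH; auto. intros x Hx. apply H, in_flat_map. eauto.
Qed.

Lemma tsub_eq_on_vars (s s' : subst) t :
  tsub s t = tsub s' t -> forall x, In x (vars t) -> s x = s' x.
Proof.
  induction t as [y|f ts IH] using term_list_ind; simpl; intros H x Hx.
  - destruct Hx as [<-|[]]; auto.
  - injection H as H. apply in_flat_map in Hx as (a & Ha & Hx).
    rewrite Forall_forall in IH. eapply IH; eauto.
    eapply ext_in_map in H; eauto.
Qed.

Lemma tsub_Var t : tsub Var t = t.
Proof.
  induction t as [x|f ts IH] using term_list_ind; simpl; auto.
  f_equal. rewrite <- (map_id ts) at 2. apply map_ext_in. now apply Forall_forall.
Qed.

Lemma fill_ccomp C D t : fill (ccomp C D) t = fill C (fill D t).
Proof. induction C; simpl; congruence. Qed.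

Lemma tsub_fill (s : subst) C t : tsub s (fill C t) = fill (csub s C) (tsub s t).
Proof. induction C; simpl; auto. rewrite map_app. simpl. congruence. Qed.

Lemma csub_comp (d s : subst) C :
  csub d (csub s C) = csub (fun x => tsub d (s x)) C.
Proof.
  induction C; simpl; auto. rewrite !map_map. f_equal; auto;
  apply map_ext; intros; apply tsub_comp.
Qed.

Lemma csub_ext (s s' : subst) C t :
  (forall x, In x (vars (fill C t)) -> s x = s' x) -> csub s C = csub s' C.
Proof.
  induction C as [|f l C IH r]; simpl; auto. intros H.
  rewrite flat_map_app in H. simpl in H. f_equal.
  - apply map_ext_in. intros a Ha. apply tsub_ext. intros x Hx. apply H.
    apply in_app_iff. left. apply in_flat_map. eauto.
  - apply IH. intros x Hx. apply H. rewrite !in_app_iff. auto.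
  - apply map_ext_in. intros a Ha. apply tsub_ext. intros x Hx. apply H.
    rewrite !in_app_iff. right. right. apply in_flat_map. eauto.
Qed.

Lemma csub_not_Hole (s : subst) C : C <> Hole -> csub s C <> Hole.
Proof. destruct C; simpl; congruence. Qed.

Lemma vars_fill C t x :
  In x (vars t) -> In x (vars (fill C t)).
Proof.
  induction C as [|f l C IH r]; simpl; auto. intros H.
  rewrite flat_map_app, in_app_iff. simpl. rewrite in_app_iff. auto.
Qed.

Lemma var_occurs_at t x : In x (vars t) -> exists C, t = fill C (Var x).
Proof.
  induction t as [y|f ts IH] using term_list_ind; simpl; intros H.
  - destruct H as [<-|[]]. now exists Hole.
  - apply in_flat_map in H as (a & Ha & Hx).
    rewrite Forall_forall in IH. destruct (IH a Ha Hx) as [C ->].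
    apply in_split in Ha as (l & r & ->). now exists (CFun f l C r).
Qed.

Lemma vars_tsub (s : subst) t y :
  In y (vars (tsub s t)) <-> exists x, In x (vars t) /\ In y (vars (s x)).
Proof.
  induction t as [x|f ts IH] using term_list_ind; simpl.
  - split; [eauto|]. intros (z & [<-|[]] & H); auto.
  - rewrite Forall_forall in IH. rewrite in_flat_map. split.
    + intros (a & Ha & Hy). apply in_map_iff in Ha as (b & <- & Hb).
      apply IH in Hy as (x & Hx & Hy); auto. exists x. split; auto.
      apply in_flat_map. eauto.
    + intros (x & Hx & Hy). apply in_flat_map in Hx as (b & Hb & Hx).
      exists (tsub s b). split; [now apply in_map|]. apply IH; eauto.
Qed.

Lemma size_pos t : 0 < size t.
Proof. destruct t; simpl; lia. Qed.

Lemma size_fill C t : size t <= size (fill C t).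
Proof.
  induction C as [|f l C IH r]; simpl; auto.
  rewrite map_app, list_sum_app. simpl. lia.
Qed.

Lemma size_fill_lt C t : C <> Hole -> size t < size (fill C t).
Proof.
  destruct C as [|f l C r]; simpl; [congruence|]. intros _.
  rewrite map_app, list_sum_app. simpl. pose proof (size_fill C t). lia.
Qed.

Definition upd (s : subst) (x : nat) (t : term) : subst :=
  fun y => if Nat.eqb x y then t else s y.

Lemma NoDup_app_disjoint (A : Type) (l r : list A) x :
  NoDup (l ++ r) -> In x l -> In x r -> False.
Proof.
  induction l as [|a l IH]; simpl; [tauto|]. intros H [->|Hl] Hr; inversion H; subst.
  - apply H2, in_app_iff; auto.
  - auto.
Qed.

(** Linearity leaves no occurrence of [x] outside the hole, so [upd] acts only there. This turns a
    step inside the value of a variable back into a substitution instance. *)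
Lemma tsub_upd_linear C x (s : subst) a :
  NoDup (vars (fill C (Var x))) ->
  tsub (upd s x a) (fill C (Var x)) = fill (csub s C) a.
Proof.
  induction C as [|f l C IH r]; simpl; intros H.
  - unfold upd. now rewrite Nat.eqb_refl.
  - rewrite flat_map_app in H. simpl in H.
    pose proof (vars_fill C (Var x) x (or_introl eq_refl)) as Hx.
    assert (Hupd : forall u, ~ In x (vars u) -> tsub (upd s x a) u = tsub s u).
    { intros u Hu. apply tsub_ext. intros y Hy. unfold upd.
      destruct (Nat.eqb_spec x y); subst; tauto. }
    rewrite map_app. simpl. f_equal. f_equal; [|f_equal].
    + apply map_ext_in. intros b Hb. apply Hupd. intros Hxb.
      eapply NoDup_app_disjoint; [exact H| |].
      * apply in_flat_map. eauto.
      * apply in_app_iff. auto.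
    + apply IH. now apply NoDup_app_remove_l, NoDup_app_remove_r in H.
    + apply map_ext_in. intros b Hb. apply Hupd. intros Hxb.
      apply NoDup_app_remove_l in H. eapply NoDup_app_disjoint; [exact H| |].
      * exact Hx.
      * apply in_flat_map. eauto.
Qed.

Lemma app_cons_eq (A : Type) (l1 r1 l2 r2 : list A) (a b : A) :
  l1 ++ a :: r1 = l2 ++ b :: r2 ->
  (l1 = l2 /\ a = b /\ r1 = r2) \/
  (exists m, l2 = l1 ++ a :: m /\ r1 = m ++ b :: r2) \/
  (exists m, l1 = l2 ++ b :: m /\ r2 = m ++ a :: r1).
Proof.
  revert l2. induction l1 as [|c l1 IH]; intros [|d l2]; simpl; intros H.
  - injection H as -> ->. auto.
  - injection H as -> ->. right. left. eauto.
  - injection H as -> <-. right. right. eauto.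
  - injection H as -> H. destruct (IH _ H) as [(-> & -> & ->)|[(m & -> & ->)|(m & -> & ->)]].
    + auto.
    + right. left. exists m. auto.
    + right. right. exists m. auto.
Qed.

(** Two positions of a term are nested or parallel. In the parallel case the function [K] plays the
    role of a two-hole context; its last two properties say that freezing either argument leaves an
    ordinary context, so steps at the two positions commute. *)
Lemma fill_eq_cases C1 C2 a b :
  fill C1 a = fill C2 b ->
  (exists D, C2 = ccomp C1 D /\ a = fill D b) \/
  (exists D, C1 = ccomp C2 D /\ b = fill D a) \/
  (exists K : term -> term -> term,
     (forall a', fill C1 a' = K a' b) /\ (forall b', fill C2 b' = K a b') /\
     (forall b', exists C, forall a', K a' b' = fill C a') /\
     (forall a', exists C, forall b', K a' b' = fill C b')).
Proof.
  revert C2. induction C1 as [|f l1 C1 IH r1]; intros C2 H.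
  - left. exists C2. auto.
  - destruct C2 as [|g l2 C2 r2].
    + right. left. exists (CFun f l1 C1 r1). simpl in H. auto.
    + simpl in H. injection H as <- H.
      apply app_cons_eq in H as [(-> & H & ->)|[(m & -> & ->)|(m & -> & ->)]].
      * destruct (IH _ H) as [(D & -> & Ha)|[(D & -> & Hb)|(K & K1 & K2 & K3 & K4)]].
        -- left. exists D. auto.
        -- right. left. exists D. auto.
        -- right. right. exists (fun a' b' => Fun f (l2 ++ K a' b' :: r2)).
           simpl. repeat split; intros.
           ++ now rewrite K1.
           ++ now rewrite K2.
           ++ destruct (K3 b') as [C HC]. exists (CFun f l2 C r2). intros. simpl. now rewrite HC.
           ++ destruct (K4 a') as [C HC]. exists (CFun f l2 C r2). intros. simpl. now rewrite HC.
      * right. right.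
        exists (fun a' b' => Fun f (l1 ++ fill C1 a' :: m ++ fill C2 b' :: r2)).
        repeat split; intros.
        -- simpl. now rewrite <- app_assoc.
        -- exists (CFun f l1 C1 (m ++ fill C2 b' :: r2)). auto.
        -- exists (CFun f (l1 ++ fill C1 a' :: m) C2 r2). intros. simpl. now rewrite <- app_assoc.
      * right. right.
        exists (fun a' b' => Fun f (l2 ++ fill C2 b' :: m ++ fill C1 a' :: r1)).
        repeat split; intros.
        -- simpl. now rewrite <- app_assoc.
        -- exists (CFun f (l2 ++ fill C2 b' :: m) C1 r1). intros. simpl. now rewrite <- app_assoc.
        -- exists (CFun f l2 C2 (m ++ fill C1 a' :: r1)). auto.
Qed.

Lemma fill_tsub_cases l : forall (s : subst) D u, tsub s l = fill D u ->
  (exists C v, l = fill C v /\ ~ is_var v /\ D = csub s C /\ u = tsub s v) \/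
  (exists C x D', l = fill C (Var x) /\ D = ccomp (csub s C) D' /\ s x = fill D' u).
Proof.
  induction l as [x|f ts IH] using term_list_ind; intros s D u H.
  - right. exists Hole, x, D. auto.
  - destruct D as [|g l D r]; simpl in H.
    + left. exists Hole, (Fun f ts). repeat split; auto. intros [x Hx]. discriminate.
    + injection H as <- H. apply map_eq_app in H as (l0 & r' & -> & <- & H).
      apply map_eq_cons in H as (t0 & r0 & -> & H & <-).
      rewrite Forall_forall in IH.
      destruct (IH t0 (in_elt _ _ _) _ _ _ H)
        as [(C & v & -> & Hv & -> & ->)|(C & x & D' & -> & -> & Hx)].
      * left. exists (CFun f l0 C r0), v. auto.
      * right. exists (CFun f l0 C r0), x, D'. auto.
Qed.

(** * Unification and renaming apart *)

Definition unifies s (L : list (term * term)) : Prop :=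
  forall p, In p L -> tsub s (fst p) = tsub s (snd p).

Definition most_general s (L : list (term * term)) : Prop :=
  unifies s L /\
  forall tau, unifies tau L -> exists delta : subst, forall x, tau x = tsub delta (s x).

Definition eqs_vars (L : list (term * term)) : list nat :=
  flat_map (fun p => vars (fst p) ++ vars (snd p)) L.

Definition eqs_size (L : list (term * term)) : nat :=
  list_sum (map (fun p => size (fst p) + size (snd p)) L).

Lemma unifies_cons s t u L :
  unifies s ((t, u) :: L) <-> tsub s t = tsub s u /\ unifies s L.
Proof.
  unfold unifies. simpl. split.
  - intros H. split; [exact (H _ (or_introl eq_refl))|auto].
  - intros [H1 H2] p [<-|Hp]; auto.
Qed.

Lemma unifies_combine s ts : forall us, length ts = length us ->
  (unifies s (combine ts us) <-> map (tsub s) ts = map (tsub s) us).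
Proof.
  induction ts as [|t ts IH]; intros [|u us] Hl; simpl in *; try discriminate.
  - split; auto. intros _ p [].
  - rewrite unifies_cons, IH by lia. split.
    + intros [-> ->]. auto.
    + intros H. now injection H.
Qed.

Lemma unifies_app s L L' : unifies s (L ++ L') <-> unifies s L /\ unifies s L'.
Proof.
  unfold unifies. setoid_rewrite in_app_iff. firstorder.
Qed.

Lemma most_general_equiv s L L' :
  (forall tau, unifies tau L <-> unifies tau L') -> most_general s L -> most_general s L'.
Proof. unfold most_general. firstorder. Qed.

Lemma occurs_check s x t : In x (vars t) -> t <> Var x -> s x <> tsub s t.
Proof.
  intros Hx Ht E. destruct (var_occurs_at _ _ Hx) as [C ->].
  rewrite tsub_fill in E. assert (HC : C <> Hole) by (intros ->; auto).
  pose proof (size_fill_lt (csub s C) (tsub s (Var x)) (csub_not_Hole s C HC)) as Hs.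
  rewrite <- E in Hs. simpl in Hs. lia.
Qed.

Lemma tsub_upd_absorb tau x t u :
  tau x = tsub tau t -> tsub tau (tsub (upd Var x t) u) = tsub tau u.
Proof.
  intros H. rewrite tsub_comp. apply tsub_ext. intros y _. unfold upd.
  destruct (Nat.eqb_spec x y); subst; auto.
Qed.

Lemma tsub_upd_fresh s x t u : ~ In x (vars u) -> tsub (upd s x t) u = tsub s u.
Proof.
  intros H. apply tsub_ext. intros y Hy. unfold upd.
  destruct (Nat.eqb_spec x y); subst; tauto.
Qed.

Lemma eqs_vars_combine ts us :
  incl (eqs_vars (combine ts us)) (flat_map (@vars F) ts ++ flat_map (@vars F) us).
Proof.
  intros x Hx. apply in_flat_map in Hx as ([t u] & Hp & Hx). simpl in Hx.
  apply in_app_iff in Hx. apply in_app_iff.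
  destruct Hx; [left|right]; apply in_flat_map; eauto using in_combine_l, in_combine_r.
Qed.

Lemma eqs_size_combine ts us :
  eqs_size (combine ts us) <= list_sum (map size ts) + list_sum (map size us).
Proof.
  unfold eqs_size. revert us. induction ts as [|t ts IH]; intros [|u us]; simpl; try lia.
  specialize (IH us). lia.
Qed.

(** Unification by decomposition and variable elimination, as a lexicographic induction on the
    length of [V], then on the size. Decomposition shrinks the size with [V] fixed; eliminating a
    variable may enlarge the equations but removes it from [V]. The given unifier excludes symbol
    clashes and occurs-check failures. *)
Lemma most_general_exists_aux : forall n m V L, length V <= n -> eqs_size L <= m ->
  incl (eqs_vars L) V -> (exists tau, unifies tau L) -> exists s, most_general s L.
Proof.
  induction n as [n IHn] using (well_founded_induction Wf_nat.lt_wf). induction m as [m IHm] using (well_founded_induction Wf_nat.lt_wf).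
  intros V L Hn Hm HV [tau Htau].
  (* The tail is arbitrary because the claim also serves an equation read from right to left. *)
  assert (Helim : forall x t L', unifies tau ((Var x, t) :: L') ->
    eqs_size L' < m -> incl (eqs_vars ((Var x, t) :: L')) V ->
    exists s, most_general s ((Var x, t) :: L')).
  { clear L Hm HV Htau. intros x t L' Htau Hm HV.
    apply unifies_cons in Htau as [Hx Htau].
    destruct (classic (t = Var x)) as [->|Hne].
    - destruct (IHm (eqs_size L') Hm V L') as [s Hs]; eauto.
      { intros y Hy. apply HV. simpl. auto. }
      exists s. eapply most_general_equiv; [|exact Hs].
      intros tau'. rewrite unifies_cons. tauto.
    - assert (Hxt : ~ In x (vars t)).
      { intros Hin. exact (occurs_check tau x t Hin Hne Hx). }
      set (e := upd Var x t).
      set (L'' := map (fun p => (tsub e (fst p), tsub e (snd p))) L').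
      assert (HL'' : forall tau', unifies tau' L'' <->
                unifies (fun y => tsub tau' (e y)) L').
      { intros tau'. unfold unifies, L''. split; intros H p Hp.
        - rewrite <- !tsub_comp.
          exact (H _ (in_map (fun p => (tsub e (fst p), tsub e (snd p))) _ _ Hp)).
        - apply in_map_iff in Hp as (q & <- & Hq). simpl. rewrite !tsub_comp. auto. }
      assert (Habs : forall tau', tau' x = tsub tau' t -> unifies tau' L' -> unifies tau' L'').
      { intros tau' Hx' H'. apply HL''. intros p Hp.
        rewrite <- !tsub_comp. unfold e. rewrite !tsub_upd_absorb; auto. }
      assert (Hlen : length (remove Nat.eq_dec x V) < length V).
      { apply remove_length_lt, HV. simpl. auto. }
      destruct (IHn (length (remove Nat.eq_dec x V))
                 (Nat.lt_le_trans _ _ _ Hlen Hn) (eqs_size L'') (remove Nat.eq_dec x V) L'' (le_n _) (le_n _)) as [s Hs].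
      { intros y Hy. unfold L'', eqs_vars in Hy. rewrite flat_map_concat_map, map_map in Hy.
        rewrite <- flat_map_concat_map in Hy. simpl in Hy.
        apply in_flat_map in Hy as (p & Hp & Hy). rewrite in_app_iff, !vars_tsub in Hy.
        assert (H' : exists z, (In z (vars (fst p)) \/ In z (vars (snd p))) /\
                     In y (vars (e z))) by firstorder.
        destruct H' as (z & Hz & Hyz). unfold e, upd in Hyz.
        destruct (Nat.eqb_spec x z) as [<-|Hne'].
        - apply in_in_remove; [intros ->; auto|]. apply HV. simpl. rewrite !in_app_iff. auto.
        - destruct Hyz as [<-|[]]. apply in_in_remove; auto. apply HV. simpl.
          rewrite in_app_iff. right. right. apply in_flat_map. exists p.
          rewrite in_app_iff. auto. }
      { exists tau. auto. }
      destruct Hs as [Hs Hgen]. exists (fun y => tsub s (e y)). split.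
      + apply unifies_cons. split; [|now apply HL''].
        rewrite <- !tsub_comp. unfold e. rewrite (tsub_upd_fresh Var x t t) by auto.
        simpl. unfold upd. now rewrite Nat.eqb_refl, tsub_Var.
      + intros tau' H'. apply unifies_cons in H' as [Hx' H'].
        destruct (Hgen tau') as [delta Hd]; auto. exists delta. intros y.
        rewrite tsub_comp, <- (tsub_ext tau') by auto.
        change (tau' y) with (tsub tau' (Var y)).
        rewrite <- (tsub_upd_absorb tau' x t) by exact Hx'. reflexivity. }
  destruct L as [|[t u] L].
  { exists Var. split; [intros p []|]. intros tau' _. exists tau'. auto. }
  unfold eqs_size in Hm. simpl in Hm. fold (eqs_size L) in Hm.
  pose proof (size_pos t). destruct t as [x|f ts].
  { apply Helim; auto. lia. }
  destruct u as [x|g us].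
  { destruct (Helim x (Fun f ts) L) as [s Hs]; auto.
    - apply unifies_cons in Htau as [H1 H2]. apply unifies_cons. auto.
    - simpl in *. lia.
    - intros y Hy. apply HV. cbn [eqs_vars flat_map fst snd] in *.
      rewrite !in_app_iff in *. tauto.
    - exists s. eapply most_general_equiv; [|exact Hs]. intros tau'.
      rewrite !unifies_cons. firstorder. }
  apply unifies_cons in Htau as [Hfg Htau]. simpl in Hfg. injection Hfg as <- Hts.
  assert (Hlen : length ts = length us).
  { apply (f_equal (@length _)) in Hts. now rewrite !length_map in Hts. }
  destruct (IHm (eqs_size (combine ts us ++ L))) with (V := V) (L := combine ts us ++ L)
    as [s Hs]; auto.
  - unfold eqs_size. rewrite map_app, list_sum_app. fold (eqs_size (combine ts us)).
    fold (eqs_size L). pose proof (eqs_size_combine ts us). simpl in Hm. lia.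
  - intros y Hy. apply HV. unfold eqs_vars in Hy. rewrite flat_map_app in Hy.
    cbn [eqs_vars flat_map fst snd]. rewrite in_app_iff in *.
    destruct Hy as [Hy|Hy]; auto. left. now apply eqs_vars_combine.
  - exists tau. rewrite unifies_app, unifies_combine; auto.
  - exists s. eapply most_general_equiv; [|exact Hs]. intros tau'.
    rewrite unifies_app, unifies_cons, unifies_combine by auto. simpl. split.
    + intros [-> H']. auto.
    + intros [E H']. injection E. auto.
Qed.

Lemma mgu_exists t u tau : tsub tau t = tsub tau u -> exists s, is_mgu s t u.
Proof.
  intros H.
  destruct (most_general_exists_aux _ _ _ [(t, u)] (le_n _) (le_n _) (incl_refl _))
    as [s [Hs Hgen]].
  { exists tau. apply unifies_cons. split; [auto|intros p []]. }
  apply unifies_cons in Hs as [Hs _]. exists s. split; auto.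
  intros tau' H'. apply Hgen, unifies_cons. split; [auto|intros p []].
Qed.

(** With [N] above all of [V], the numbers below [N] trade places with those from [N] to [2N - 1].
    Such an exchange is an involution, hence a renaming with itself as inverse. *)
Lemma renaming_apart (V : list nat) :
  exists pi, (forall x, pi (pi x) = x) /\ forall x, In x V -> ~ In (pi x) V.
Proof.
  set (N := S (list_max V)).
  assert (HN : forall x, In x V -> x < N).
  { intros x Hx. unfold N. apply Nat.lt_succ_r.
    pose proof (proj1 (list_max_le V (list_max V)) (le_n _)) as H.
    rewrite Forall_forall in H. auto. }
  exists (fun x => if x <? N then x + N else if x <? N + N then x - N else x). split.
  - intros x.
    destruct (Nat.ltb_spec x N).
    + destruct (Nat.ltb_spec (x + N) N); [lia|].
      destruct (Nat.ltb_spec (x + N) (N + N)); lia.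
    + destruct (Nat.ltb_spec x (N + N)).
      * destruct (Nat.ltb_spec (x - N) N); lia.
      * destruct (Nat.ltb_spec x N); [lia|]. destruct (Nat.ltb_spec x (N + N)); lia.
  - intros x Hx H. apply HN in Hx. apply HN in H. destruct (Nat.ltb_spec x N); lia.
Qed.

(** * Rewriting and critical pairs *)

Definition ctx_closed (r : rel F) : Prop :=
  forall C a b, r a b -> r (fill C a) (fill C b).
Definition sub_closed (r : rel F) : Prop :=
  forall s a b, r a b -> r (tsub s a) (tsub s b).

Lemma rt_map (r r' : rel F) (f : term -> term) a b :
  (forall x y, r x y -> r' (f x) (f y)) -> rt r a b -> rt r' (f a) (f b).
Proof.
  intros H. induction 1; [apply rt_step; auto|apply rt_refl|eapply rt_trans; eauto].
Qed.

Lemma rt_sym (r : rel F) a b :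
  (forall x y, r x y -> r y x) -> rt r a b -> rt r b a.
Proof.
  intros H. induction 1; [apply rt_step; auto|apply rt_refl|eapply rt_trans; eauto].
Qed.

Lemma rt_incl (r r' : rel F) a b :
  (forall x y, r x y -> rt r' x y) -> rt r a b -> rt r' a b.
Proof.
  intros H. induction 1; [auto|apply rt_refl|eapply rt_trans; eauto].
Qed.

Lemma rt_ctx r : ctx_closed r -> ctx_closed (rt r).
Proof. intros H C a b. apply rt_map with (f := fill C). auto. Qed.

Lemma rt_sub r : sub_closed r -> sub_closed (rt r).
Proof. intros H s a b. apply rt_map with (f := tsub s). auto. Qed.

Lemma symr_ctx r : ctx_closed r -> ctx_closed (symr r).
Proof. intros H C a b [Hr|Hr]; [left|right]; auto. Qed.

Lemma symr_sub r : sub_closed r -> sub_closed (symr r).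
Proof. intros H s a b [Hr|Hr]; [left|right]; auto. Qed.

Lemma comp_ctx r r' : ctx_closed r -> ctx_closed r' -> ctx_closed (comp r r').
Proof. intros H H' C a b (x & Hx & Hy). exists (fill C x). auto. Qed.

Lemma comp_sub r r' : sub_closed r -> sub_closed r' -> sub_closed (comp r r').
Proof. intros H H' s a b (x & Hx & Hy). exists (tsub s x). auto. Qed.

Lemma rstep_ctx (R : trs) : ctx_closed (rstep R).
Proof.
  intros C a b (C' & l & r & s & HR & -> & ->).
  exists (ccomp C C'), l, r, s. now rewrite !fill_ccomp.
Qed.

Lemma rstep_sub (R : trs) : sub_closed (rstep R).
Proof.
  intros s a b (C & l & r & s' & HR & -> & ->).
  exists (csub s C), l, r, (fun x => tsub s (s' x)).
  now rewrite !tsub_fill, !tsub_comp.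
Qed.

Lemma rstep_root (R : trs) l r s : R (l, r) -> rstep R (tsub s l) (tsub s r).
Proof. intros H. now exists Hole, l, r, s. Qed.

Lemma rstep_rule (R : trs) l r : R (l, r) -> rstep R l r.
Proof.
  intros H. rewrite <- (tsub_Var l), <- (tsub_Var r). now apply rstep_root.
Qed.

Lemma rstep_incl_closed (R : trs) (r : rel F) a b : ctx_closed r -> sub_closed r ->
  (forall x y, R (x, y) -> r x y) -> rstep R a b -> r a b.
Proof. intros Hc Hs H (C & x & y & s & HR & -> & ->). auto. Qed.

Lemma rstep_mono (R R' : trs) a b :
  (forall p, R p -> R' p) -> rstep R a b -> rstep R' a b.
Proof. intros H (C & l & r & s & HR & -> & ->). exists C, l, r, s. auto. Qed.

Lemma rstep_pm (B : trs) a b : rstep (pm B) a b <-> symr (rstep B) a b.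
Proof.
  split.
  - intros (C & l & r & s & [HB|HB] & -> & ->); [left; now exists C, l, r, s|right; now exists C, r, l, s].
  - intros [(C & l & r & s & HB & -> & ->)|(C & l & r & s & HB & -> & ->)].
    + exists C, l, r, s. repeat split; auto. now left.
    + exists C, r, l, s. repeat split; auto. now right.
Qed.

Lemma simB_ctx (B : trs) : ctx_closed (simB B).
Proof. apply rt_ctx, symr_ctx, rstep_ctx. Qed.

Lemma simB_sub (B : trs) : sub_closed (simB B).
Proof. apply rt_sub, symr_sub, rstep_sub. Qed.

Lemma simB_refl (B : trs) a : simB B a a.
Proof. apply rt_refl. Qed.

Lemma simB_sym (B : trs) a b : simB B a b -> simB B b a.
Proof. apply rt_sym. intros x y [H|H]; [right|left]; auto. Qed.

Lemma simB_trans (B : trs) a b c : simB B a b -> simB B b c -> simB B a c.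
Proof. apply rt_trans. Qed.

Lemma simB_pm (B : trs) a b : rstep (pm B) a b -> simB B a b.
Proof. intros H. apply rt_step. now apply rstep_pm. Qed.

Lemma rstep_mod_ctx (B R : trs) : ctx_closed (rstep_mod B R).
Proof. apply comp_ctx; [apply simB_ctx|apply comp_ctx; [apply rstep_ctx|apply simB_ctx]]. Qed.

Lemma rstep_mod_sub (B R : trs) : sub_closed (rstep_mod B R).
Proof. apply comp_sub; [apply simB_sub|apply comp_sub; [apply rstep_sub|apply simB_sub]]. Qed.

Lemma rt_tsub_pointwise (r : rel F) s s' t : ctx_closed r ->
  (forall x, rt r (s x) (s' x)) -> rt r (tsub s t) (tsub s' t).
Proof.
  intros Hr H. induction t as [x|f ts IH] using term_list_ind; simpl; auto.
  (* [l] accumulates the arguments already rewritten, from left to right. *)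
  assert (Hl : forall l, rt r (Fun f (l ++ map (tsub s) ts)) (Fun f (l ++ map (tsub s') ts))).
  { induction IH as [|t ts Ht _ IH]; intros l; simpl; [apply rt_refl|].
    apply rt_trans with (Fun f (l ++ tsub s' t :: map (tsub s) ts)).
    - exact (rt_ctx _ Hr (CFun f l Hole _) _ _ Ht).
    - specialize (IH (l ++ [tsub s' t])). now rewrite <- !app_assoc in IH. }
  exact (Hl []).
Qed.

Lemma rt_tsub_upd (r : rel F) s x a t : ctx_closed r -> r (s x) a ->
  rt r (tsub s t) (tsub (upd s x a) t).
Proof.
  intros Hr H. apply rt_tsub_pointwise; auto. intros y. unfold upd.
  destruct (Nat.eqb_spec x y); subst; [now apply rt_step|apply rt_refl].
Qed.

(** Primality of an overlap, read on the instantiated redex rather than on the most general one. *)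
Definition proper_NF (R : trs) t : Prop :=
  forall C v, C <> Hole -> t = fill C v -> NF R v.

(** If the redex at hand is not innermost, one of its proper subterms is reducible and strictly
    smaller, and the search continues there. *)
Lemma innermost_redex (R : trs) t : (exists t', rstep R t t') ->
  exists C l r s, R (l, r) /\ t = fill C (tsub s l) /\ proper_NF R (tsub s l).
Proof.
  remember (size t) as n eqn:Hn. revert t Hn.
  induction n as [n IH] using (well_founded_induction Wf_nat.lt_wf).
  intros t -> (t' & C & l & r & s & HR & -> & _).
  destruct (classic (proper_NF R (tsub s l))) as [HN|HN].
  - exists C, l, r, s. auto.
  - apply not_all_ex_not in HN as [D HN]. apply not_all_ex_not in HN as [v HN].
    apply imply_to_and in HN as [HD HN]. apply imply_to_and in HN as [Hv HN].
    apply NNPP in HN.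
    destruct (IH (size v)) with (t := v) as (C' & l' & r' & s' & HR' & -> & HP); auto.
    { rewrite Hv. eapply Nat.lt_le_trans; [exact (size_fill_lt D v HD)|apply size_fill]. }
    exists (ccomp C (ccomp D C')), l', r', s'. rewrite !fill_ccomp, Hv. auto.
Qed.

Lemma proper_NF_or_redex (R : trs) t : proper_NF R t \/
  exists C l r s, R (l, r) /\ t = fill C (tsub s l) /\ proper_NF R (tsub s l).
Proof.
  destruct (classic (exists t', rstep R t t')) as [H|H].
  - right. now apply innermost_redex.
  - left. intros C v _ -> [t' Ht]. apply H. exists (fill C t'). now apply rstep_ctx.
Qed.

Lemma renaming_id : renaming (fun x => x).
Proof. now exists (fun x => x). Qed.

(** The critical pair lemma with primality. Renaming the first rule apart merges [s] and [tau] into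
    one unifier [rho], which factors through an mgu [mu] by [delta]. A redex in a proper subterm of
    the [mu]-instance would be mapped by [delta] to one in a proper subterm of [tsub tau l1],
    against [proper_NF]; hence the pair is prime. *)
Lemma prime_overlap_cases (R1 R2 R : trs) l1 r1 l2 r2 tau s D :
  R1 (l1, r1) -> R2 (l2, r2) -> tsub s l2 = fill D (tsub tau l1) ->
  proper_NF R (tsub tau l1) ->
  (exists C x D', l2 = fill C (Var x) /\ D = ccomp (csub s C) D' /\
     s x = fill D' (tsub tau l1)) \/
  (D = Hole /\ variant (l1, r1) (l2, r2)) \/
  (exists a0 b0 (delta : subst), PCP2 R1 R2 R a0 b0 /\
     fill D (tsub tau r1) = tsub delta a0 /\ tsub s r2 = tsub delta b0).
Proof.
  intros H1 H2 HD HN.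
  destruct (fill_tsub_cases _ _ _ _ HD) as [(C & v & Hl2 & Hv & -> & Hlv)|H]; [right|now left].
  destruct (renaming_apart (vars l1 ++ vars r1 ++ vars l2 ++ vars r2)) as (pi & Hpi & Hfresh).
  set (V2 := vars l2 ++ vars r2).
  (* On the second rule [rho] acts as [s]; elsewhere it undoes the involution [pi] and acts as
     [tau]. *)
  set (rho := fun x => if in_dec Nat.eq_dec x V2 then s x else tau (pi x)).
  assert (Hrho2 : forall w, incl (vars w) V2 -> tsub rho w = tsub s w).
  { intros w Hw. apply tsub_ext. intros x Hx. unfold rho.
    destruct (in_dec Nat.eq_dec x V2) as [|Hn]; auto. now destruct (Hn (Hw x Hx)). }
  assert (Hdisj : forall x, In x (vars l1 ++ vars r1) -> ~ In (pi x) V2).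
  { intros x Hx Hin. apply (Hfresh x).
    - rewrite !in_app_iff in *. tauto.
    - unfold V2 in Hin. rewrite !in_app_iff in *. tauto. }
  assert (Hrho1 : forall w, incl (vars w) (vars l1 ++ vars r1) ->
            tsub rho (tsub (ren_sub F pi) w) = tsub tau w).
  { intros w Hw. rewrite tsub_comp. apply tsub_ext. intros x Hx. simpl. unfold rho.
    destruct (in_dec Nat.eq_dec (pi x) V2) as [Hin|_].
    - now apply Hdisj in Hin; [|apply Hw].
    - now rewrite Hpi. }
  assert (Hl1 : tsub rho (tsub (ren_sub F pi) l1) = tsub tau l1)
    by (apply Hrho1, incl_appl, incl_refl).
  assert (Hvv : tsub rho v = tsub s v).
  { apply Hrho2, incl_appl. rewrite Hl2. intros x. apply vars_fill. }
  assert (Hu : tsub rho (tsub (ren_sub F pi) l1) = tsub rho v) by congruence.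
  destruct (mgu_exists _ _ _ Hu) as [mu [Hmu Hgen]].
  destruct (Hgen rho Hu) as [delta Hdelta].
  assert (Hd : forall w, tsub rho w = tsub delta (tsub mu w)).
  { intros w. rewrite tsub_comp. apply tsub_ext. auto. }
  set (l1' := tsub (ren_sub F pi) l1) in *. set (r1' := tsub (ren_sub F pi) r1).
  assert (Hback : forall w, tsub (ren_sub F pi) (tsub (ren_sub F pi) w) = w).
  { intros w. rewrite tsub_comp. rewrite <- (tsub_Var w) at 2. apply tsub_ext.
    intros x _. unfold ren_sub. simpl. unfold ren_sub. now rewrite Hpi. }
  destruct (classic (C = Hole /\ variant (l1', r1') (l2, r2)))
    as [[-> (q & (q' & Hq1 & Hq2) & Hl & Hr)]|Hnv].
  - left. split; auto. exists (fun x => pi (q x)). split; [|split].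
    + exists (fun x => q' (pi x)). split; intros x.
      * now rewrite Hpi.
      * now rewrite Hq2.
    + simpl in *. rewrite <- (Hback l1). fold l1'. rewrite Hl, tsub_comp. reflexivity.
    + simpl in *. rewrite <- (Hback r1). fold r1'. rewrite Hr, tsub_comp. reflexivity.
  - right. exists (fill (csub mu C) (tsub mu r1')), (tsub mu r2), delta. split; [|split].
    + exists l1', r1', l2, r2, C, v, mu. split; [|split; [|split; [|split;
        [|split; [|split; [|split; [|split; [|split]]]]]]]].
      * exists (l1, r1). split; auto. exists pi. split; [now exists pi|auto].
      * exists (l2, r2). split; auto. exists (fun x => x). split; [apply renaming_id|].
        now rewrite !tsub_Var.
      * intros x Hx Hin. rewrite in_app_iff in Hx. unfold l1', r1' in Hx.
        rewrite !vars_tsub in Hx. unfold ren_sub in Hx. simpl in Hx.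
        assert (Hy : exists y, In y (vars l1 ++ vars r1) /\ pi y = x).
        { destruct Hx as [(y & Hy & [<-|[]])|(y & Hy & [<-|[]])]; exists y;
          rewrite in_app_iff; auto. }
        destruct Hy as (y & Hy & <-). now apply (Hdisj y).
      * auto.
      * auto.
      * tauto.
      * now split.
      * auto.
      * auto.
      * intros C' w HC' Hw [w' Hw'].
        apply (HN (csub delta C') (tsub delta w)).
        -- now apply csub_not_Hole.
        -- now rewrite <- Hl1, Hu, Hd, Hw, tsub_fill.
        -- exists (tsub delta w'). now apply rstep_sub.
    + rewrite tsub_fill, <- Hd. unfold r1'. rewrite Hrho1 by apply incl_appr, incl_refl.
      f_equal. rewrite csub_comp. apply csub_ext with (t := v). intros x Hx.
      rewrite <- Hdelta. unfold rho.
      destruct (in_dec Nat.eq_dec x V2) as [|Hn]; auto. destruct Hn.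
      unfold V2. rewrite Hl2. apply in_app_iff. auto.
    + rewrite <- Hd. symmetry. apply Hrho2, incl_appr, incl_refl.
Qed.

(** * Local confluence modulo from prime critical pairs *)

Section Confluence.
Variable gt : rel F.
Variables B R : trs.
Hypothesis Hgt : B_compatible_reduction_order B gt.
Hypothesis HB : forall l r, B (l, r) ->
  NoDup (vars l) /\ NoDup (vars r) /\ forall x, In x (vars l) <-> In x (vars r).
Hypothesis HR : forall l r, R (l, r) -> gt l r.
Hypothesis Hlin : left_linear R.

Lemma gt_irrefl a : ~ gt a a.
Proof. apply Hgt. Qed.

Lemma gt_trans a b c : gt a b -> gt b c -> gt a c.
Proof. apply Hgt. Qed.

Lemma gt_wf : well_founded (invr gt).
Proof. apply Hgt. Qed.

Lemma gt_ctx : ctx_closed gt.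
Proof. intros C a b. apply Hgt. Qed.

Lemma gt_sub : sub_closed gt.
Proof. intros s a b. apply Hgt. Qed.

Lemma gt_sim_l a b c : simB B a b -> gt b c -> gt a c.
Proof. intros H1 H2. apply (proj2 Hgt a b c c); auto using simB_refl. Qed.

Lemma gt_sim_r a b c : gt a b -> simB B b c -> gt a c.
Proof. intros H1 H2. apply (proj2 Hgt a a c b); auto using simB_refl. Qed.

Lemma not_gt_sim a b : gt a b -> simB B a b -> False.
Proof. intros H1 H2. apply (gt_irrefl a). eapply gt_sim_r; eauto using simB_sym. Qed.

Lemma rstep_gt_of (S : trs) : (forall l r, S (l, r) -> gt l r) ->
  forall a b, rstep S a b -> gt a b.
Proof. intros H a b. apply rstep_incl_closed; auto using gt_ctx, gt_sub. Qed.

Lemma rstep_gt a b : rstep R a b -> gt a b.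
Proof. now apply rstep_gt_of. Qed.

Lemma rsteps_gt a b : rt (rstep R) a b -> a = b \/ gt a b.
Proof.
  induction 1 as [a b H| |a b c _ [->|H1] _ [->|H2]]; eauto using rstep_gt, gt_trans.
Qed.

(* If [r] contains a variable [x] not in [l], instantiating [x] by [l] gives [l > C[l]]. *)
Lemma gt_vars l r x : gt l r -> In x (vars r) -> In x (vars l).
Proof.
  intros H Hr. apply NNPP. intros Hl.
  destruct (var_occurs_at _ _ Hr) as [C ->].
  pose proof (gt_sub (upd Var x l) _ _ H) as H'.
  rewrite tsub_upd_fresh, tsub_Var, tsub_fill in H' by auto. simpl in H'.
  unfold upd at 2 in H'. rewrite Nat.eqb_refl in H'.
  set (D := csub (upd Var x l) C) in H'.
  assert (Hloop : forall t, ~ gt t (fill D t)).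
  { intros t. induction t as [t IH] using (well_founded_induction gt_wf).
    intros Ht. apply (IH (fill D t)); auto. now apply gt_ctx. }
  now apply (Hloop l).
Qed.

(** Bounding sets for conversions: [gt w] for those below [w], the set of all terms for unrestricted
    ones, so that one chaining argument serves both. *)
Definition down_closed (Q : term -> Prop) : Prop :=
  forall a b, Q a -> gt a b \/ simB B a b -> Q b.

Definition conv_in (Q : term -> Prop) : rel F :=
  rt (fun a b => Q a /\ Q b /\ (rstep R a b \/ rstep R b a \/ rstep (pm B) a b)).

Definition below (w : term) : rel F := conv_in (gt w).

Lemma down_closed_gt w : down_closed (gt w).
Proof. intros a b H [H'|H']; eauto using gt_trans, gt_sim_r. Qed.

Lemma conv_in_refl Q a : conv_in Q a a.
Proof. apply rt_refl. Qed.

Lemma conv_in_trans Q a b c : conv_in Q a b -> conv_in Q b c -> conv_in Q a c.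
Proof. apply rt_trans. Qed.

Lemma conv_in_sym Q a b : conv_in Q a b -> conv_in Q b a.
Proof.
  apply rt_sym. intros x y (Hx & Hy & H). repeat split; auto.
  rewrite rstep_pm in *. unfold symr in *. tauto.
Qed.

Lemma conv_in_mono (Q Q' : term -> Prop) a b :
  (forall c, Q c -> Q' c) -> conv_in Q a b -> conv_in Q' a b.
Proof. intros H. apply rt_incl. intros x y (Hx & Hy & Hs). apply rt_step. auto. Qed.

Lemma below_mono w w' a b : gt w' w \/ simB B w' w -> below w a b -> below w' a b.
Proof.
  intros H. apply conv_in_mono. intros c Hc. destruct H; eauto using gt_trans, gt_sim_l.
Qed.

Lemma below_ctx C w a b : below w a b -> below (fill C w) (fill C a) (fill C b).
Proof.
  apply rt_map. intros x y (Hx & Hy & H). repeat split; auto using gt_ctx.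
  destruct H as [H|[H|H]]; [left|right; left|right; right]; now apply rstep_ctx.
Qed.

Lemma below_sub s w a b : below w a b -> below (tsub s w) (tsub s a) (tsub s b).
Proof.
  apply rt_map. intros x y (Hx & Hy & H). repeat split; auto using gt_sub.
  destruct H as [H|[H|H]]; [left|right; left|right; right]; now apply rstep_sub.
Qed.

Lemma conv_in_rsteps Q a b : down_closed Q -> Q a -> rt (rstep R) a b -> conv_in Q a b.
Proof.
  intros HQ Ha H. apply clos_rt_rt1n in H.
  induction H as [a|a b c H _ IH]; [apply rt_refl|].
  assert (Hb : Q b) by (apply (HQ a); auto using rstep_gt).
  apply rt_trans with b; [apply rt_step; auto|exact (IH Hb)].
Qed.

Lemma conv_in_sim Q a b : down_closed Q -> Q a -> simB B a b -> conv_in Q a b.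
Proof.
  intros HQ Ha H. apply clos_rt_rt1n in H.
  induction H as [a|a b c H _ IH]; [apply rt_refl|].
  assert (Hb : Q b) by (apply (HQ a); auto; right; now apply rt_step).
  apply rt_trans with b; [apply rt_step|exact (IH Hb)].
  repeat split; auto. right. right. now apply rstep_pm.
Qed.

Lemma conv_in_join Q a b : down_closed Q -> Q a -> Q b ->
  joinable_sim B R a b -> conv_in Q a b.
Proof.
  intros HQ Ha Hb (u & v & Hu & Huv & Hv).
  apply conv_in_trans with u; [now apply conv_in_rsteps|].
  apply conv_in_trans with v.
  - apply conv_in_sim; auto. destruct (rsteps_gt _ _ Hu) as [<-|H]; auto. apply (HQ a); auto.
  - apply conv_in_sym. now apply conv_in_rsteps.
Qed.

(* The shape required of a cliff [a <- u <-> b]: the side [b], which is equivalent to the source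
   [u], has to make a step before the conversion can stay below [u]. *)
Definition cliff_below (u a b : term) : Prop :=
  exists b', rstep R b b' /\ below u a b'.

Lemma cliff_below_ctx C u a b :
  cliff_below u a b -> cliff_below (fill C u) (fill C a) (fill C b).
Proof. intros (b' & H1 & H2). exists (fill C b'). split; [now apply rstep_ctx|now apply below_ctx]. Qed.

Hypothesis Hpeak : forall a b s Q, PCP R a b -> down_closed Q ->
  Q (tsub s a) -> Q (tsub s b) -> conv_in Q (tsub s a) (tsub s b).
(** A critical pair does not record which side came from the equation: in [PCPpm] it is the right or
    the left one, according to the order of the overlap. Both readings are therefore required, and
    [u] stands for the instantiated source. *)
Hypothesis Hcliff : forall a b s u, PCPpm R B a b ->
  (gt u (tsub s a) -> simB B u (tsub s b) -> cliff_below u (tsub s a) (tsub s b)) /\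
  (gt u (tsub s b) -> simB B u (tsub s a) -> cliff_below u (tsub s b) (tsub s a)).

(** * Closing local peaks and cliffs *)

Lemma pm_spec l r : pm B (l, r) ->
  NoDup (vars l) /\ NoDup (vars r) /\ forall x, In x (vars l) <-> In x (vars r).
Proof.
  intros [H|H]; apply HB in H as (H1 & H2 & H3); auto.
  repeat split; auto; apply H3.
Qed.

(** A rule strictly decreases while an equation stays inside one equivalence class, and renaming
    changes neither. *)
Lemma pm_not_variant l1 r1 l2 r2 : R (l1, r1) -> pm B (l2, r2) ->
  variant (l1, r1) (l2, r2) \/ variant (l2, r2) (l1, r1) -> False.
Proof.
  intros H1 H2 [(pi & _ & Hl & Hr)|(pi & _ & Hl & Hr)]; simpl in *.
  - apply (not_gt_sim l1 r1); auto. rewrite Hl, Hr. now apply simB_pm, rstep_root.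
  - apply (not_gt_sim (tsub (ren_sub F pi) l1) (tsub (ren_sub F pi) r1)).
    + now apply gt_sub, HR.
    + rewrite <- Hl, <- Hr. now apply simB_pm, rstep_rule.
Qed.

(** Matching fixes the substitution on the variables of the left-hand side, and by [gt_vars] the
    right-hand side has no others. *)
Lemma variant_same_result l1 r1 l2 r2 tau s : R (l1, r1) -> R (l2, r2) ->
  variant (l1, r1) (l2, r2) -> tsub s l2 = tsub tau l1 -> tsub s r2 = tsub tau r1.
Proof.
  intros H1 H2 (pi & _ & Hl & Hr) E. simpl in *. subst l1 r1.
  rewrite tsub_comp in *. apply tsub_ext. intros x Hx.
  eapply tsub_eq_on_vars in E; [exact E|]. eapply gt_vars; eauto.
Qed.

Lemma prime_peak_below l1 r1 l2 r2 tau s D : R (l1, r1) -> R (l2, r2) ->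
  tsub s l2 = fill D (tsub tau l1) -> proper_NF R (tsub tau l1) ->
  below (tsub s l2) (fill D (tsub tau r1)) (tsub s r2).
Proof.
  intros H1 H2 HD HN.
  assert (G1 : gt (tsub s l2) (fill D (tsub tau r1))).
  { rewrite HD. now apply gt_ctx, gt_sub, HR. }
  assert (G2 : gt (tsub s l2) (tsub s r2)) by now apply gt_sub, HR.
  destruct (prime_overlap_cases R R R _ _ _ _ _ _ _ H1 H2 HD HN)
    as [(C & x & D' & Hl & -> & Hx)|[[-> Hv]|(a & b & d & Hcp & Ha & Hb)]].
  (* Variable overlap: as [l2] is linear, contracting inside the value of [x] leaves an instance of
     [l2], which catches up by one step; the other side rewrites all copies of [x] in [r2]. *)
  - set (c := fill D' (tsub tau r1)).
    assert (Hc : rstep R (s x) c).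
    { rewrite Hx. now apply rstep_ctx, rstep_root. }
    apply conv_in_trans with (tsub (upd s x c) r2).
    + apply conv_in_rsteps; auto using down_closed_gt.
      rewrite fill_ccomp. fold c.
      rewrite <- (tsub_upd_linear C x s c) by (rewrite <- Hl; eauto).
      rewrite <- Hl. now apply rt_step, rstep_root.
    + apply conv_in_sym, conv_in_rsteps; auto using down_closed_gt.
      apply rt_tsub_upd; auto using rstep_ctx.
  - simpl in *. rewrite (variant_same_result l1 r1 l2 r2 tau s); auto. apply conv_in_refl.
  - rewrite Ha, Hb in *. apply Hpeak; auto using down_closed_gt.
Qed.

Lemma root_peak_below l1 r1 l2 r2 tau s D : R (l1, r1) -> R (l2, r2) ->
  tsub s l2 = fill D (tsub tau l1) ->
  below (tsub s l2) (fill D (tsub tau r1)) (tsub s r2).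
Proof.
  intros H1 H2 HD.
  destruct (proper_NF_or_redex R (tsub tau l1)) as [HN|(D3 & l3 & r3 & s3 & H3 & E3 & HN)].
  - now apply prime_peak_below with l1.
  - apply conv_in_trans with (fill (ccomp D D3) (tsub s3 r3)).
    + apply conv_in_sym. rewrite HD, fill_ccomp. apply below_ctx.
      now apply prime_peak_below with l3.
    + apply prime_peak_below with l3; auto. now rewrite fill_ccomp, <- E3.
Qed.

Lemma peak_below u a b : rstep R u a -> rstep R u b -> below u a b.
Proof.
  intros Ha Hb. pose proof (rstep_gt _ _ Ha) as Ga. pose proof (rstep_gt _ _ Hb) as Gb.
  destruct Ha as (C1 & l1 & r1 & s1 & H1 & E1 & ->).
  destruct Hb as (C2 & l2 & r2 & s2 & H2 & -> & ->).
  destruct (fill_eq_cases _ _ _ _ (eq_sym E1)) as [(D & -> & E)|[(D & -> & E)|(K & K1 & K2 & K3 & K4)]].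
  - rewrite fill_ccomp, <- E, fill_ccomp. apply below_ctx, conv_in_sym.
    now apply root_peak_below with l2.
  - rewrite fill_ccomp. apply below_ctx. now apply root_peak_below with l1.
  - rewrite (K2 (tsub s2 l2)), (K1 (tsub s1 r1)) in Ga.
    rewrite (K2 (tsub s2 l2)), (K2 (tsub s2 r2)) in Gb.
    rewrite (K2 (tsub s2 l2)), (K2 (tsub s2 r2)), (K1 (tsub s1 r1)). apply conv_in_trans with (K (tsub s1 r1) (tsub s2 r2)).
    + apply conv_in_rsteps; auto using down_closed_gt. apply rt_step.
      destruct (K4 (tsub s1 r1)) as [C HC]. rewrite !HC. now apply rstep_ctx, rstep_root.
    + apply conv_in_sym, conv_in_rsteps; auto using down_closed_gt. apply rt_step.
      destruct (K3 (tsub s2 r2)) as [C HC]. rewrite !HC. now apply rstep_ctx, rstep_root.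
Qed.

Lemma prime_inner_cliff_below l1 r1 l2 r2 tau s D : R (l1, r1) -> pm B (l2, r2) ->
  tsub s l2 = fill D (tsub tau l1) -> proper_NF R (tsub tau l1) ->
  cliff_below (tsub s l2) (fill D (tsub tau r1)) (tsub s r2).
Proof.
  intros H1 H2 HD HN.
  assert (G1 : gt (tsub s l2) (fill D (tsub tau r1))).
  { rewrite HD. now apply gt_ctx, gt_sub, HR. }
  assert (G2 : simB B (tsub s l2) (tsub s r2)) by now apply simB_pm, rstep_root.
  destruct (prime_overlap_cases R (pm B) R _ _ _ _ _ _ _ H1 H2 HD HN)
    as [(C & x & D' & Hl & -> & Hx)|[[-> Hv]|(a & b & d & Hcp & Ha & Hb)]].
  (* The equation is linear with the same variables on both sides, so [x] occurs exactly once in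
     [r2]: the equational side has a step, and a single one reaches the updated instance. *)
  - set (c := fill D' (tsub tau r1)). destruct (pm_spec _ _ H2) as (N1 & N2 & HV).
    assert (Hx2 : In x (vars r2)).
    { apply HV. rewrite Hl. apply vars_fill. simpl. auto. }
    apply var_occurs_at in Hx2 as [C2 Hr].
    exists (tsub (upd s x c) r2). split.
    + rewrite Hr at 2. rewrite tsub_upd_linear by (now rewrite <- Hr).
      rewrite Hr, tsub_fill. apply rstep_ctx. simpl. rewrite Hx.
      now apply rstep_ctx, rstep_root.
    + rewrite fill_ccomp in *. fold c in G1 |- *.
      rewrite <- (tsub_upd_linear C x s c) in * by (now rewrite <- Hl).
      apply conv_in_sim; auto using down_closed_gt. rewrite <- Hl.
      now apply simB_pm, rstep_root.
  - exfalso. eapply pm_not_variant; eauto.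
  - destruct (Hcliff a b d (tsub s l2) (or_introl Hcp)) as [H _].
    rewrite Ha, Hb in *. auto.
Qed.

(** An innermost redex inside [tsub tau l1] forms a prime cliff with the equation, which supplies
    the step from the equational side; its contractum and the original one are joined by a peak with
    the same source. *)
Lemma inner_cliff_below l1 r1 l2 r2 tau s D : R (l1, r1) -> pm B (l2, r2) ->
  tsub s l2 = fill D (tsub tau l1) ->
  cliff_below (tsub s l2) (fill D (tsub tau r1)) (tsub s r2).
Proof.
  intros H1 H2 HD.
  destruct (proper_NF_or_redex R (tsub tau l1)) as [HN|(D3 & l3 & r3 & s3 & H3 & E3 & HN)].
  - now apply prime_inner_cliff_below with l1.
  - assert (E : tsub s l2 = fill (ccomp D D3) (tsub s3 l3)) by now rewrite fill_ccomp, <- E3.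
    destruct (prime_inner_cliff_below _ _ _ _ _ _ _ H3 H2 E HN) as (b' & Hb & Hbb).
    exists b'. split; auto. eapply conv_in_trans; [|exact Hbb].
    apply peak_below.
    + rewrite HD. now apply rstep_ctx, rstep_root.
    + rewrite E. now apply rstep_ctx, rstep_root.
Qed.

(** Here the equation sits inside the rule. If its instantiated side is reducible, an innermost
    redex there forms a cliff with the equation alone, which is then placed under [D]; a peak from
    the common source links it to the outer rule. *)
Lemma outer_cliff_below l1 r1 l2 r2 tau s D : pm B (l1, r1) -> R (l2, r2) ->
  tsub s l2 = fill D (tsub tau l1) ->
  cliff_below (tsub s l2) (tsub s r2) (fill D (tsub tau r1)).
Proof.
  intros H1 H2 HD.
  assert (G1 : simB B (tsub s l2) (fill D (tsub tau r1))).
  { rewrite HD. now apply simB_ctx, simB_pm, rstep_root. }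
  assert (G2 : gt (tsub s l2) (tsub s r2)) by now apply gt_sub, HR.
  destruct (proper_NF_or_redex R (tsub tau l1)) as [HN|(D3 & l3 & r3 & s3 & H3 & E3 & HN)].
  - destruct (prime_overlap_cases (pm B) R R _ _ _ _ _ _ _ H1 H2 HD HN)
      as [(C & x & D' & Hl & -> & Hx)|[[-> Hv]|(a & b & d & Hcp & Ha & Hb)]].
    + set (c := fill D' (tsub tau r1)).
      assert (Hc : symr (rstep B) (s x) c).
      { rewrite Hx. apply rstep_pm. now apply rstep_ctx, rstep_root. }
      exists (tsub (upd s x c) r2). split.
      * rewrite fill_ccomp. fold c.
        rewrite <- (tsub_upd_linear C x s c) by (rewrite <- Hl; eauto).
        rewrite <- Hl. now apply rstep_root.
      * apply conv_in_sim; auto using down_closed_gt.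
        apply rt_tsub_upd; auto. apply symr_ctx, rstep_ctx.
    + exfalso. eapply pm_not_variant; eauto.
    + destruct (Hcliff a b d (tsub s l2) (or_intror Hcp)) as [_ H].
      rewrite Ha, Hb in *. auto.
  - destruct (inner_cliff_below l3 r3 l1 r1 s3 tau D3) as (b' & Hb & Hbb); auto.
    exists (fill D b'). split; [now apply rstep_ctx|].
    apply conv_in_trans with (fill D (fill D3 (tsub s3 r3))).
    + apply peak_below; [now apply rstep_root|]. rewrite HD, E3.
      now apply rstep_ctx, rstep_ctx, rstep_root.
    + rewrite HD. now apply below_ctx.
Qed.

Lemma cliffs_below u a b : rstep R u a -> rstep (pm B) u b -> cliff_below u a b.
Proof.
  intros Ha Hb. pose proof (rstep_gt _ _ Ha) as Ga. pose proof (simB_pm _ _ _ Hb) as Gb.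
  destruct Ha as (C1 & l1 & r1 & s1 & H1 & E1 & ->).
  destruct Hb as (C2 & l2 & r2 & s2 & H2 & -> & ->).
  destruct (fill_eq_cases _ _ _ _ (eq_sym E1)) as [(D & -> & E)|[(D & -> & E)|(K & K1 & K2 & K3 & K4)]].
  - rewrite fill_ccomp, <- E, fill_ccomp. apply cliff_below_ctx.
    now apply outer_cliff_below with l2.
  - rewrite fill_ccomp. apply cliff_below_ctx. now apply inner_cliff_below with l1.
  - rewrite (K2 (tsub s2 l2)), (K1 (tsub s1 r1)) in Ga.
    rewrite (K2 (tsub s2 l2)), (K2 (tsub s2 r2)) in Gb.
    rewrite (K2 (tsub s2 l2)), (K2 (tsub s2 r2)), (K1 (tsub s1 r1)). exists (K (tsub s1 r1) (tsub s2 r2)). split.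
    + destruct (K3 (tsub s2 r2)) as [C HC]. rewrite !HC. now apply rstep_ctx, rstep_root.
    + apply conv_in_sim; auto using down_closed_gt. apply simB_pm.
      destruct (K4 (tsub s1 r1)) as [C HC]. rewrite !HC. now apply rstep_ctx, rstep_root.
Qed.

(** * Newman's lemma modulo *)

Definition nf_of (a n : term) : Prop := rt (rstep R) a n /\ NF R n.

Lemma nf_exists a : exists n, nf_of a n.
Proof.
  induction a as [a IH] using (well_founded_induction gt_wf).
  destruct (classic (NF R a)) as [H|H].
  - exists a. split; auto. apply rt_refl.
  - apply NNPP in H as [b Hb]. destruct (IH b (rstep_gt _ _ Hb)) as (n & Hn & HN).
    exists n. split; auto. apply rt_trans with b; auto. now apply rt_step.
Qed.

Lemma nf_of_rstep a b n : rstep R a b -> nf_of b n -> nf_of a n.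
Proof. intros H [H1 H2]. split; auto. apply rt_trans with b; auto. now apply rt_step. Qed.

Lemma nf_of_inv a n : nf_of a n -> (a = n /\ NF R a) \/ exists b, rstep R a b /\ nf_of b n.
Proof.
  intros [H1 H2]. apply clos_rt_rt1n in H1. destruct H1 as [|b n H1 H]; auto.
  right. exists b. split; auto. split; auto. now apply clos_rt1n_rt.
Qed.

(** Not reflexive by definition: [unique_nf a a] already says that the normal forms of [a] agree up
    to [B], which is how confluence enters. *)
Definition unique_nf (a b : term) : Prop :=
  forall m n, nf_of a m -> nf_of b n -> simB B m n.

Lemma unique_nf_trans a b c : unique_nf a b -> unique_nf b c -> unique_nf a c.
Proof.
  intros H1 H2 m n Hm Hn. destruct (nf_exists b) as [k Hk].
  apply simB_trans with k; auto.
Qed.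

(** Transitivity of [unique_nf] lets the steps of a conversion be treated one by one. Across a rule
    step, every normal form of the reduct is one of the source, so the diagonal instance
    suffices. *)
Lemma conv_in_unique_nf (Q : term -> Prop) :
  (forall a b, Q a -> a = b \/ rstep (pm B) a b -> unique_nf a b) ->
  forall a b, Q a -> conv_in Q a b -> unique_nf a b.
Proof.
  intros HQ a b Ha H. apply clos_rt_rt1n in H.
  induction H as [a|a b c (_ & Hb & H) _ IH]; [auto|].
  apply unique_nf_trans with b; auto. destruct H as [H|[H|H]]; auto.
  - intros m n Hm Hn. apply (HQ a a); eauto using nf_of_rstep.
  - intros m n Hm Hn. apply (HQ b b); eauto using nf_of_rstep.
Qed.

(** Equational steps do not decrease, so the induction runs on a representative [u] of the class
    rather than on [a]. The alternative [a = b] is carried along because conversions below [a] need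
    both kinds of pairs. *)
Lemma unique_nf_sim_step u : forall a b, simB B u a -> a = b \/ rstep (pm B) a b ->
  unique_nf a b.
Proof.
  induction u as [u IH] using (well_founded_induction gt_wf). intros a b Hua Hab.
  assert (Hbelow : forall c c' : term, below a c c' -> gt a c -> unique_nf c c').
  { intros c c' H Hc. apply (conv_in_unique_nf (gt a)); auto.
    intros x y Hx. apply (IH x); [|apply simB_refl]. eapply gt_sim_l; eauto. }
  intros m n Hm Hn.
  destruct (nf_of_inv _ _ Hm) as [[<- HN]|(a' & Ha & Hm')].
  - destruct Hab as [<-|Hab].
    + destruct (nf_of_inv _ _ Hn) as [[<- _]|(b' & Hb & _)]; [apply simB_refl|].
      destruct HN. eauto.
    + destruct (nf_of_inv _ _ Hn) as [[<- _]|(b' & Hb & _)]; [now apply simB_pm|].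
      (* If [b] were reducible, the reversed cliff would give the normal form [a] a step. *)
      assert (Hba : rstep (pm B) b a) by (rewrite rstep_pm in *; unfold symr in *; tauto).
      destruct (cliffs_below _ _ _ Hb Hba) as (a' & Ha & _). destruct HN. eauto.
  - destruct Hab as [<-|Hab].
    + destruct (nf_of_inv _ _ Hn) as [[<- HN]|(b' & Hb & Hn')]; [destruct HN; eauto|].
      apply (Hbelow a' b'); auto using rstep_gt, peak_below.
    (* The cliff links [a'] to [b'] below [a]; a peak at [b] then links [b'] to the first step [c]
       of the reduction from [b] to [n]. *)
    + destruct (cliffs_below _ _ _ Ha Hab) as (b' & Hb & Hab').
      destruct (nf_exists b') as [k Hk]. apply simB_trans with k.
      * apply (Hbelow a' b'); auto using rstep_gt.
      * destruct (nf_of_inv _ _ Hn) as [[<- HN]|(c & Hc & Hn')]; [destruct HN; eauto|].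
        assert (Gb : gt a b').
        { apply gt_sim_l with b; auto using rstep_gt, simB_pm. }
        apply (Hbelow b' c); auto. apply below_mono with b; [right|now apply peak_below].
        now apply simB_pm.
Qed.

Lemma church_rosser_modulo a b : conv_in (fun _ => True) a b -> joinable_sim B R a b.
Proof.
  intros H.
  assert (Hu : unique_nf a b).
  { apply (conv_in_unique_nf (fun _ => True)); auto.
    intros x y _. apply unique_nf_sim_step with x, simB_refl. }
  destruct (nf_exists a) as [m Hm], (nf_exists b) as [n Hn].
  exists m, n. repeat split; [apply Hm| |apply Hn]. now apply Hu.
Qed.

End Confluence.

(** * Correctness of fair runs *)

Lemma joinable_sim_sub (B R : trs) : sub_closed (joinable_sim B R).
Proof.
  intros s a b (u & v & Hu & Huv & Hv). exists (tsub s u), (tsub s v).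
  repeat split; [|now apply simB_sub|]; apply rt_sub; auto; apply rstep_sub.
Qed.

Lemma joinable_sim_sym (B R : trs) a b : joinable_sim B R a b -> joinable_sim B R b a.
Proof. intros (u & v & Hu & Huv & Hv). exists v, u. auto using simB_sym. Qed.

Lemma rstep_union (S T : trs) a b :
  rstep (Defs.union S T) a b <-> rstep S a b \/ rstep T a b.
Proof.
  split.
  - intros (C & l & r & s & [H|H] & -> & ->); [left|right]; now apply rstep_ctx, rstep_root.
  - intros [H|H]; revert H; apply rstep_mono; intros p Hp; [left|right]; auto.
Qed.

Section Runs.
Variable gt : rel F.
Variable B : trs.
Hypothesis Hgt : B_compatible_reduction_order B gt.
Hypothesis HB : forall l r, B (l, r) ->
  NoDup (vars l) /\ NoDup (vars r) /\ forall x, In x (vars l) <-> In x (vars r).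

Lemma gt_down_closed w : down_closed gt B (gt w).
Proof. now apply down_closed_gt. Qed.

Definition oriented (S : trs) : Prop := forall l r, S (l, r) -> gt l r.

(** A cliff rule is oriented because its left-hand side is equivalent to the source that rewrites to
    its right-hand side; Compose only makes a right-hand side smaller. *)
Lemma IA_step_oriented (st st' : trs * trs) :
  IA_step B gt st st' -> oriented (snd st) -> oriented (snd st').
Proof.
  destruct st as [E S], st' as [E' S']. unfold oriented. simpl.
  intros [(a & b & _ & _ & HS)|[(a & b & (u & Hu & Hub) & _ & HS)|
    [(E0 & a & b & _ & Hab & _ & HS)|[(E0 & a & b & _ & _ & _ & HS)|
    [(E0 & a & b & u & _ & _ & _ & HS)|[(S0 & a & b & u & [_ HS0] & _ & _ & HS)|
    (S0 & a & b & u & [_ HS0] & Hu & _ & HS)]]]]]] HO l r H; apply HS in H; auto.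
  - destruct H as [H|H]; auto. injection H as -> ->.
    apply (gt_sim_l gt B Hgt) with u.
    + apply simB_sym. now apply rt_step.
    + revert Hu. now apply (rstep_gt_of gt B Hgt).
  - destruct H as [H|H]; auto. now injection H as -> ->.
  - apply HO, HS0. auto.
  - destruct H as [H|H]; [apply HO, HS0; auto|]. injection H as -> ->.
    destruct Hu as (c & Hc & c' & Hc' & Hu). apply (gt_trans gt B Hgt) with b.
    + apply HO, HS0. auto.
    + apply (gt_sim_l gt B Hgt) with c; auto. apply (gt_sim_r gt B Hgt) with c'; auto.
      revert Hc'. apply (rstep_gt_of gt B Hgt). intros. apply HO, HS0. auto.
Qed.

(** * Backward persistence of rules and equations along a run *)

Section Persistence.
Variable R : trs.
Hypothesis HR : oriented R.

(** This has the shape of a cliff diagram, since [a] itself is not below [a]: its first step is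
    exposed, and the rest stays strictly under it. *)
Definition rules_persist (S : trs) : Prop :=
  forall a b, rstep S a b -> exists a', rstep R a a' /\ below gt B R a a' b.

(** The sides of an equation need not be comparable, so neither bounds the other; an arbitrary [Q]
    containing both takes the place of [below]. *)
Definition equations_persist (S : trs) : Prop :=
  forall Q a b, down_closed gt B Q -> Q a -> Q b -> rstep S a b -> conv_in B R Q a b.

Lemma rules_persist_of_rules (S : trs) :
  (forall l r, S (l, r) -> exists a', rstep R l a' /\ below gt B R l a' r) ->
  rules_persist S.
Proof.
  intros H a b.
  apply rstep_incl_closed with (r := fun a b => exists a', rstep R a a' /\ below gt B R a a' b);
    auto.
  - intros C x y (a' & H1 & H2). exists (fill C a').
    split; [now apply rstep_ctx|now apply (below_ctx gt B R Hgt)].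
  - intros s x y (a' & H1 & H2). exists (tsub s a').
    split; [now apply rstep_sub|now apply (below_sub gt B R Hgt)].
Qed.

Lemma rules_persist_conv_in (S : trs) Q a b : rules_persist S -> down_closed gt B Q ->
  Q a -> rstep S a b -> conv_in B R Q a b.
Proof.
  intros HS HQ Ha H. destruct (HS _ _ H) as (a' & H1 & H2).
  assert (Q a') by (apply (HQ a); auto; left; now apply (rstep_gt gt B R Hgt HR)).
  apply conv_in_trans with a'; [apply rt_step; auto|].
  revert H2. apply conv_in_mono. intros c Hc. apply (HQ a); auto.
Qed.

Lemma rules_persist_mod (S : trs) Q a b : rules_persist S -> oriented S ->
  down_closed gt B Q -> Q a -> rstep_mod B S a b -> conv_in B R Q a b.
Proof.
  intros HS HO HQ Ha (x & Hx & y & Hxy & Hy).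
  assert (Q x) by (apply (HQ a); auto).
  assert (Q y) by (apply (HQ x); auto; left; revert Hxy; now apply (rstep_gt_of gt B Hgt)).
  apply conv_in_trans with x; [now apply (conv_in_sim gt)|].
  apply conv_in_trans with y; [now apply rules_persist_conv_in with S|].
  now apply (conv_in_sim gt).
Qed.

Lemma rstep_mod_gt (S : trs) a b : oriented S -> rstep_mod B S a b -> gt a b.
Proof.
  intros HO (x & Hx & y & Hxy & Hy). apply (gt_sim_l gt B Hgt) with x; auto.
  apply (gt_sim_r gt B Hgt) with y; auto. revert Hxy. now apply (rstep_gt_of gt B Hgt).
Qed.

(** Only Collapse and Compose lose rules. When Collapse turns [a -> b] into [(u, b)], the step
    [a -> u] persists, and the equation has both sides below [a]. After Compose, [a -> u] is
    available and the conversion between [b] and [u] stays below [a]. *)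
Lemma IA_step_rules_persist E S E' S' : IA_step B gt (E, S) (E', S') ->
  oriented S -> oriented S' -> rules_persist S' -> equations_persist E' -> rules_persist S.
Proof.
  simpl. intros Hst HO HO' HS' HE'.
  assert (Hkeep : forall l r, S' (l, r) ->
            exists a', rstep R l a' /\ below gt B R l a' r).
  { intros l r H. apply HS', rstep_rule, H. }
  apply rules_persist_of_rules. intros l r H.
  destruct Hst as [(a & b & _ & _ & HS)|[(a & b & _ & _ & HS)|
    [(E0 & a & b & _ & Hab & _ & HS)|[(E0 & a & b & _ & _ & _ & HS)|
    [(E0 & a & b & u & _ & _ & _ & HS)|[(S0 & a & b & u & [_ HS0] & Hu & HE & HS)|
    (S0 & a & b & u & [_ HS0] & Hu & _ & HS)]]]]]];
    try (apply Hkeep, HS; now auto).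
  - apply HS0 in H. destruct H as [H|H]; [now apply Hkeep, HS|]. injection H as -> ->.
    assert (Hab : gt a b) by (apply HO, HS0; auto).
    apply (rstep_mono _ S') in Hu; [|intros; now apply HS].
    destruct (HS' _ _ Hu) as (a' & H1 & H2). exists a'. split; auto.
    apply conv_in_trans with u; auto. apply HE'; auto using gt_down_closed.
    + revert Hu. now apply (rstep_gt_of gt B Hgt).
    + apply rstep_rule, HE. auto.
  - apply HS0 in H. destruct H as [H|H]; [apply Hkeep, HS; auto|]. injection H as -> ->.
    assert (Hab : gt a b) by (apply HO, HS0; auto).
    assert (Hu' : rstep_mod B S' b u).
    { destruct Hu as (x & Hx & y & Hxy & Hy). exists x. split; auto. exists y. split; auto.
      revert Hxy. apply rstep_mono. intros p Hp. apply HS. auto. }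
    destruct (Hkeep a u) as (a' & H1 & H2); [apply HS; auto|].
    exists a'. split; auto. apply conv_in_trans with u; auto. apply conv_in_sym.
    apply rules_persist_mod with S'; auto using gt_down_closed.
Qed.

(** A lost equation has become a rule, was an equivalence, or was simplified to some [(u, b)]; in
    the last case [u] is smaller than [a] and hence in [Q], so the assumption on [E'] applies. *)
Lemma IA_step_equations_persist E S E' S' : IA_step B gt (E, S) (E', S') ->
  oriented S -> oriented S' -> rules_persist S' -> equations_persist E' ->
  equations_persist E.
Proof.
  simpl. intros Hst HO HO' HS' HE' Q x y HQ Hx Hy (C & l & r & s & H & -> & ->).
  assert (Hkeep : E' (l, r) -> conv_in B R Q (fill C (tsub s l)) (fill C (tsub s r))).
  { intros H'. apply HE'; auto. now apply rstep_ctx, rstep_root. }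
  assert (Hcase : forall (E0 : trs) a b, is_dadd E0 (a, b) E \/ is_dadd E0 (b, a) E ->
    (Q (fill C (tsub s a)) -> Q (fill C (tsub s b)) ->
       conv_in B R Q (fill C (tsub s a)) (fill C (tsub s b))) ->
    (forall p, E0 p -> E' p) -> conv_in B R Q (fill C (tsub s l)) (fill C (tsub s r))).
  { intros E0 a b Hd Hc HE0.
    assert (H' : E0 (l, r) \/ (l, r) = (a, b) \/ (l, r) = (b, a)).
    { destruct Hd as [[_ Hd]|[_ Hd]]; apply Hd in H; tauto. }
    destruct H' as [H'|[H'|H']]; auto; injection H' as -> ->; auto using conv_in_sym. }
  destruct Hst as [(a & b & _ & HE & _)|[(a & b & _ & HE & _)|
    [(E0 & a & b & Hd & Hab & HE & HS)|[(E0 & a & b & Hd & Hab & HE & _)|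
    [(E0 & a & b & u & Hd & Hu & HE & HS)|[(S0 & a & b & u & _ & _ & HE & _)|
    (S0 & a & b & u & _ & _ & HE & _)]]]]]];
    try (apply Hkeep, HE; now auto).
  - apply (Hcase E0 a b); auto; [|intros p Hp; now apply HE]. intros Ha Hb.
    apply rules_persist_conv_in with S'; auto. apply rstep_ctx, rstep_root, HS. auto.
  - apply (Hcase E0 a b); auto; [|intros p Hp; now apply HE]. intros Ha Hb.
    apply (conv_in_sim gt); auto. now apply simB_ctx, simB_sub.
  - apply (Hcase E0 a b); auto; [|intros p Hp; apply HE; auto]. intros Ha Hb.
    assert (Hu' : rstep_mod B S' (fill C (tsub s a)) (fill C (tsub s u))).
    { destruct Hu as (c & Hc & c' & Hcc & Hc').
      exists (fill C (tsub s c)). split; [now apply simB_ctx, simB_sub|].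
      exists (fill C (tsub s c')). split; [|now apply simB_ctx, simB_sub].
      apply rstep_ctx, rstep_sub. revert Hcc. apply rstep_mono. intros p Hp. now apply HS. }
    apply conv_in_trans with (fill C (tsub s u)).
    + now apply rules_persist_mod with S'.
    + apply HE'; auto.
      * apply (HQ (fill C (tsub s a))); auto. left. now apply rstep_mod_gt with S'.
      * apply rstep_ctx, rstep_root, HE. auto.
Qed.

End Persistence.

Theorem fair_run_church_rosser (E : trs) (n : nat) (sq : nat -> trs * trs) :
  is_run (IA_step B gt) E n sq -> fair_run B n sq -> same (fst (sq n)) (@empty_trs F) ->
  forall a b, conv (Defs.union E B) a b -> joinable_sim B (snd (sq n)) a b.
Proof.
  intros (HE0 & HR0 & Hstep) (Hlin & Hpcp & Hpm) HEn. set (R := snd (sq n)) in *.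
  assert (HO : forall i, i <= n -> oriented (snd (sq i))).
  { induction i as [|i IH]; intros Hi.
    - intros l r H. apply HR0 in H. destruct H.
    - eapply IA_step_oriented; [apply Hstep; lia|apply IH; lia]. }
  assert (HR : oriented R) by (apply HO; auto).
  (* Backward induction: [k] counts the distance from the end of the run. *)
  assert (Hpers : forall k, k <= n ->
    rules_persist R (snd (sq (n - k))) /\ equations_persist R (fst (sq (n - k)))).
  { induction k as [|k IH]; intros Hk.
    - rewrite Nat.sub_0_r. split.
      + intros a b H. exists b. split; [exact H|apply conv_in_refl].
      + intros Q a b _ _ _ (C & l & r & s & H & _). apply HEn in H. destruct H.
    - destruct IH as [IH1 IH2]; [lia|].
      assert (Hi : S (n - S k) = n - k) by lia.
      pose proof (Hstep (n - S k) ltac:(lia)) as H. rewrite Hi in H.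
      pose proof (HO (n - k) ltac:(lia)) as HO1. pose proof (HO (n - S k) ltac:(lia)) as HO2.
      destruct (sq (n - S k)) as [Ei Si], (sq (n - k)) as [Ei' Si'].
      simpl in HO1, HO2, IH1, IH2 |- *. split.
      + now apply IA_step_rules_persist with Ei Ei' Si'.
      + now apply IA_step_equations_persist with Si Ei' Si'. }
  assert (HRi : forall i, i <= n -> rules_persist R (snd (sq i))).
  { intros i Hi. replace i with (n - (n - i)) by lia. apply Hpers. lia. }
  assert (HEi : forall i, i <= n -> equations_persist R (fst (sq i))).
  { intros i Hi. replace i with (n - (n - i)) by lia. apply Hpers. lia. }
  assert (Hpeak : forall a b s Q, PCP R a b -> down_closed gt B Q ->
    Q (tsub s a) -> Q (tsub s b) -> conv_in B R Q (tsub s a) (tsub s b)).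
  { intros a b s Q Hcp HQ Ha Hb.
    destruct (Hpcp _ _ Hcp) as [H|(i & Hi & H)].
    - apply (conv_in_join gt B R Hgt HR); auto. now apply joinable_sim_sub.
    - apply (symr_sub _ (rstep_sub _) s) in H.
      destruct H as [H|H]; [|apply conv_in_sym]; apply rstep_union in H as [H|H].
      + now apply (HEi i).
      + now apply rules_persist_conv_in with (snd (sq i)); auto.
      + now apply (HEi i).
      + now apply rules_persist_conv_in with (snd (sq i)); auto. }
  (* If [a] and [b] join at [x] and [y], then [b] must move, since otherwise [gt u x] with [x]
     equivalent to [u]. A rule step from [a] to [b] would give [gt u b] with [b] equivalent to [u].
     A rule step from [b] to [a] persists and exposes the required step. *)
  assert (Hclose : forall a b u, joinable_sim B R a b \/
      (exists i, i <= n /\ symr (rstep (snd (sq i))) a b) ->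
      gt u a -> simB B u b -> cliff_below gt B R u a b).
  { intros a b u [(x & y & Hx & Hxy & Hy)|(i & Hi & [H|H])] Hua Hub.
    - assert (Hux : gt u x).
      { destruct (rsteps_gt gt B R Hgt HR _ _ Hx) as [<-|H]; auto.
        now apply (gt_trans gt B Hgt) with a. }
      apply clos_rt_rt1n in Hy. destruct Hy as [|b' y Hb Hy].
      + exfalso. apply (not_gt_sim gt B Hgt u x); auto.
        apply simB_trans with b; auto using simB_sym.
      + apply clos_rt1n_rt in Hy. exists b'. split; auto.
        apply (conv_in_join gt B R Hgt HR); auto using gt_down_closed.
        * apply (gt_sim_l gt B Hgt) with b; auto. now apply (rstep_gt gt B R Hgt HR).
        * exists x, y. auto.
    - exfalso. apply (not_gt_sim gt B Hgt u b); auto.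
      apply (gt_trans gt B Hgt) with a; auto. revert H. apply (rstep_gt_of gt B Hgt).
      now apply HO.
    - destruct (HRi i Hi _ _ H) as (b' & H1 & H2). exists b'. split; auto.
      apply conv_in_sym. apply (below_mono gt B R Hgt) with b; auto. }
  assert (Hcliff : forall a b s u, PCPpm R B a b ->
    (gt u (tsub s a) -> simB B u (tsub s b) -> cliff_below gt B R u (tsub s a) (tsub s b)) /\
    (gt u (tsub s b) -> simB B u (tsub s a) -> cliff_below gt B R u (tsub s b) (tsub s a))).
  { intros a b s u Hcp.
    destruct (Hpm _ _ Hcp) as [H|(i & Hi & H)].
    - apply (joinable_sim_sub _ _ s) in H. split; apply Hclose; auto using joinable_sim_sym.
    - apply (symr_sub _ (rstep_sub _) s) in H.
      split; apply Hclose; right; exists i; split; auto. destruct H; [right|left]; auto. }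
  intros a b Hab. apply (church_rosser_modulo gt B R Hgt HB HR Hlin Hpeak Hcliff).
  revert Hab. apply rt_incl.
  assert (HQ : down_closed gt B (fun _ => True)) by now intros ? ? ? ?.
  assert (H1 : forall x y, rstep (Defs.union E B) x y -> conv_in B R (fun _ => True) x y).
  { intros x y H. apply rstep_union in H as [H|H].
    - rewrite <- HE0 in H. apply (HEi 0); auto. lia.
    - apply (conv_in_sim gt); auto. apply rt_step. now left. }
  intros x y [H|H]; [|apply conv_in_sym]; now apply H1.
Qed.

End Runs.

(** * Simulation *)

Section Simulation.
Variable gt : rel F.
Variable ac : F -> Prop.
Notation B := (ACeqs ac).
Hypothesis Hgt : B_compatible_reduction_order B gt.

(** * Runs of the target system: composition, soundness, finiteness *)

Definition KB_steps : trs * trs -> trs * trs -> Prop :=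
  clos_refl_trans_n1 _ (KBAC_step ac gt).

Lemma KB_steps_refl st : KB_steps st st.
Proof. constructor. Qed.

Lemma KB_steps_one st st' : KBAC_step ac gt st st' -> KB_steps st st'.
Proof. intros H. econstructor; [exact H|constructor]. Qed.

Lemma KB_steps_trans st1 st2 st3 : KB_steps st1 st2 -> KB_steps st2 st3 -> KB_steps st1 st3.
Proof. intros H1 H2. induction H2; auto. econstructor; eauto. Qed.

Lemma KB_steps_run st st' : KB_steps st st' ->
  exists m sq, sq 0 = st /\ sq m = st' /\ forall i, i < m -> KBAC_step ac gt (sq i) (sq (S i)).
Proof.
  induction 1 as [|st1 st2 Hst _ (m & sq & H0 & Hm & Hsq)].
  - exists 0, (fun _ => st). repeat split. intros i Hi. lia.
  - exists (S m), (fun i => if i <=? m then sq i else st2). split; [|split].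
    + exact H0.
    + destruct (Nat.leb_spec (S m) m); [lia|auto].
    + intros i Hi. destruct (Nat.leb_spec i m); [|lia].
      destruct (Nat.leb_spec (S i) m); [apply Hsq; lia|].
      replace i with m by lia. now rewrite Hm.
Qed.

Lemma conv_ctx (S : trs) : ctx_closed (conv S).
Proof. apply rt_ctx, symr_ctx, rstep_ctx. Qed.

Lemma conv_sub (S : trs) : sub_closed (conv S).
Proof. apply rt_sub, symr_sub, rstep_sub. Qed.

Lemma conv_sym (S : trs) a b : conv S a b -> conv S b a.
Proof. apply rt_sym. intros x y [H|H]; [right|left]; auto. Qed.

Lemma conv_of_rstep (S T : trs) a b :
  (forall l r, S (l, r) -> conv T l r) -> rstep S a b -> conv T a b.
Proof. intros H. apply rstep_incl_closed; auto using conv_ctx, conv_sub. Qed.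

Lemma conv_union_sim (S T : trs) a b : simB T a b -> conv (Defs.union S T) a b.
Proof.
  apply rt_incl. intros x y [H|H]; apply rt_step; [left|right]; apply rstep_union; auto.
Qed.

Lemma conv_of_rstep_mod (S T : trs) a b :
  (forall l r, S (l, r) -> conv (Defs.union T B) l r) ->
  rstep_mod B S a b -> conv (Defs.union T B) a b.
Proof.
  intros H (x & Hx & y & Hxy & Hy). apply rt_trans with x; [now apply conv_union_sim|].
  apply rt_trans with y; [|now apply conv_union_sim]. revert Hxy. now apply conv_of_rstep.
Qed.

Definition sound (E : trs) (st : trs * trs) : Prop :=
  forall l r, fst st (l, r) \/ snd st (l, r) -> conv (Defs.union E B) l r.

Definition finite (S : trs) : Prop := exists L, forall p, S p -> In p L.

Lemma finite_incl_add (S S' : trs) e :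
  (forall p, S p -> S' p \/ p = e) -> finite S' -> finite S.
Proof.
  intros H [L HL]. exists (e :: L). intros p Hp. destruct (H p Hp); simpl; auto.
Qed.

Lemma KBAC_step_sound E st st' : KBAC_step ac gt st st' -> sound E st -> sound E st'.
Proof.
  destruct st as [E1 S], st' as [E2 S']. unfold sound. simpl. intros Hst H.
  set (T := Defs.union E B) in *.
  assert (HS : forall x y, rstep S x y -> conv T x y)
    by (intros x y; apply conv_of_rstep; auto).
  assert (Heq : forall (E0 : trs) a b, is_dadd E0 (a, b) E1 \/ is_dadd E0 (b, a) E1 ->
    conv T a b /\ forall l r, E0 (l, r) -> conv T l r).
  { intros E0 a b [[_ Hd]|[_ Hd]]; split; try (intros l r Hlr); [| |apply conv_sym|];
      apply H; left; apply Hd; auto. }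
  assert (Hrule : forall (S0 : trs) a b, is_dadd S0 (a, b) S ->
    conv T a b /\ forall l r, S0 (l, r) -> conv T l r).
  { intros S0 a b [_ Hd]; split; try (intros l r Hlr); apply H; right; apply Hd; auto. }
  destruct Hst as [(a & b & (u & Hu & v & Huv & Hv) & HE & HS')|
    [(E0 & a & b & Hd & _ & HE & HS')|[(E0 & a & b & Hd & _ & HE & HS')|
    [(E0 & a & b & u & Hd & Hu & HE & HS')|[(S0 & a & b & u & Hd & Hu & HE & HS')|
    (S0 & a & b & u & Hd & Hu & HE & HS')]]]]]; intros l r [Hlr|Hlr];
    try (apply HE in Hlr); try (apply HS' in Hlr); auto.
  - destruct Hlr as [Hlr|Hlr]; auto. injection Hlr as -> ->.
    apply rt_trans with u; [now apply conv_sym, HS|].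
    apply rt_trans with v; [now apply conv_union_sim|now apply HS].
  - now apply (Heq E0 a b).
  - destruct Hlr as [Hlr|Hlr]; auto. injection Hlr as -> ->. now apply (Heq E0).
  - apply (Heq E0 a b); auto.
  - destruct Hlr as [Hlr|Hlr]; [now apply (Heq E0 a b)|]. injection Hlr as -> ->.
    apply rt_trans with a; [|now apply (Heq E0)].
    apply conv_sym. apply conv_of_rstep_mod with S; auto.
  - destruct (Hrule _ _ _ Hd) as [Hab H0].
    destruct Hlr as [Hlr|Hlr]; auto. injection Hlr as -> ->.
    apply rt_trans with a; [|exact Hab]. apply conv_sym. now apply conv_of_rstep_mod with S0.
  - now apply (Hrule S0 a b).
  - destruct (Hrule _ _ _ Hd) as [Hab H0].
    destruct Hlr as [Hlr|Hlr]; auto. injection Hlr as -> ->.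
    apply rt_trans with b; [exact Hab|]. now apply conv_of_rstep_mod with S0.
Qed.

Lemma KBAC_step_finite st st' : KBAC_step ac gt st st' -> finite (fst st) -> finite (fst st').
Proof.
  destruct st as [E1 S], st' as [E2 S']. simpl. intros Hst H.
  destruct Hst as [(a & b & _ & HE & _)|
    [(E0 & a & b & Hd & _ & HE & _)|[(E0 & a & b & Hd & _ & HE & _)|
    [(E0 & a & b & u & Hd & _ & HE & _)|[(S0 & a & b & u & _ & _ & HE & _)|
    (S0 & a & b & u & _ & _ & HE & _)]]]]].
  - apply (finite_incl_add _ E1 (a, b)); auto. intros p. apply HE.
  - apply (finite_incl_add _ E1 (a, b)); auto. intros p Hp. apply HE in Hp.
    left. destruct Hd as [[_ Hd]|[_ Hd]]; apply Hd; auto.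
  - apply (finite_incl_add _ E1 (a, b)); auto. intros p Hp. apply HE in Hp.
    left. apply Hd; auto.
  - apply (finite_incl_add _ E1 (u, b)); auto. intros p Hp. apply HE in Hp.
    destruct Hp; auto. left. destruct Hd as [[_ Hd]|[_ Hd]]; apply Hd; auto.
  - apply (finite_incl_add _ E1 (u, b)); auto. intros p. apply HE.
  - apply (finite_incl_add _ E1 (a, b)); auto. intros p Hp. left. now apply HE.
Qed.

(** Finiteness travels backwards because a step removes at most one equation; the empty last set
    thus forces the initial one to be finite. *)
Lemma IA_step_finite st st' : IA_step B gt st st' -> finite (fst st') -> finite (fst st).
Proof.
  destruct st as [E1 S], st' as [E2 S']. simpl. intros Hst H.
  destruct Hst as [(a & b & _ & HE & _)|[(a & b & _ & HE & _)|
    [(E0 & a & b & Hd & _ & HE & _)|[(E0 & a & b & Hd & _ & HE & _)|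
    [(E0 & a & b & u & Hd & _ & HE & _)|[(S0 & a & b & u & _ & _ & HE & _)|
    (S0 & a & b & u & _ & _ & HE & _)]]]]]].
  - apply (finite_incl_add _ E2 (a, b)); auto. intros p Hp. left. apply HE. auto.
  - apply (finite_incl_add _ E2 (a, b)); auto. intros p Hp. left. now apply HE.
  - destruct Hd as [[_ Hd]|[_ Hd]]; [apply (finite_incl_add _ E2 (a, b))|
      apply (finite_incl_add _ E2 (b, a))]; auto; intros p Hp; apply Hd in Hp;
      destruct Hp as [Hp|Hp]; auto; left; apply HE; auto.
  - destruct Hd as [_ Hd]. apply (finite_incl_add _ E2 (a, b)); auto; intros p Hp.
    apply Hd in Hp. destruct Hp as [Hp|Hp]; auto; left; apply HE; auto.
  - destruct Hd as [[_ Hd]|[_ Hd]]; [apply (finite_incl_add _ E2 (a, b))|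
      apply (finite_incl_add _ E2 (b, a))]; auto; intros p Hp; apply Hd in Hp;
      destruct Hp as [Hp|Hp]; auto; left; apply HE; auto.
  - apply (finite_incl_add _ E2 (u, b)); auto. intros p Hp. left. apply HE. auto.
  - apply (finite_incl_add _ E2 (u, b)); auto. intros p Hp. left. now apply HE.
Qed.

Lemma KB_steps_sound E st st' : KB_steps st st' -> sound E st -> sound E st'.
Proof. induction 1; eauto using KBAC_step_sound. Qed.

Lemma KB_steps_finite st st' : KB_steps st st' -> finite (fst st) -> finite (fst st').
Proof. induction 1; eauto using KBAC_step_finite. Qed.

(* The first step keeps its exact result: only then can it be the side of a Deduce inference. *)
Definition reduces (S : trs) : rel F := fun a b =>
  exists x c, simB B a x /\ rstep S x c /\ rt (rstep_mod B S) c b.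

(** The equations that can be produced at any moment, by deducing the first reducts of both sides
    and simplifying. A growing rule set preserves this. *)
Definition peak_of (S : trs) (e : term * term) : Prop :=
  exists v, reduces S v (fst e) /\ reduces S v (snd e).

Definition swap (e : term * term) : term * term := (snd e, fst e).

Definition simplifies (S : trs) (e e' : term * term) : Prop :=
  exists a b u, (e = (a, b) \/ e = (b, a)) /\ rstep_mod B S a u /\ e' = (u, b).

(** Simplify puts the rewritten side first, so orientation is not preserved along a sequence;
    closing under [swap] makes it irrelevant. *)
Definition simplifies_to (S : trs) (e x : term * term) : Prop :=
  exists x', clos_refl_trans_1n _ (simplifies S) e x' /\ (x' = x \/ x' = swap x).

Definition incl_trs (S S' : trs) : Prop := forall p, S p -> S' p.

Lemma swap_swap e : swap (swap e) = e.
Proof. now destruct e. Qed.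

Lemma rstep_mod_mono (S S' : trs) a b :
  incl_trs S S' -> rstep_mod B S a b -> rstep_mod B S' a b.
Proof.
  intros H (x & Hx & y & Hxy & Hy). exists x. split; auto. exists y. split; auto.
  revert Hxy. now apply rstep_mono.
Qed.

Lemma rsteps_mod_mono (S S' : trs) a b :
  incl_trs S S' -> rt (rstep_mod B S) a b -> rt (rstep_mod B S') a b.
Proof. intros H. apply rt_incl. intros. apply rt_step. now apply rstep_mod_mono with S. Qed.

Lemma reduces_mono (S S' : trs) a b : incl_trs S S' -> reduces S a b -> reduces S' a b.
Proof.
  intros H (x & c & Hx & Hxc & Hc). exists x, c. repeat split; auto.
  - revert Hxc. now apply rstep_mono.
  - now apply rsteps_mod_mono with S.
Qed.

Lemma peak_of_mono (S S' : trs) e : incl_trs S S' -> peak_of S e -> peak_of S' e.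
Proof. intros H (v & H1 & H2). exists v. split; eapply reduces_mono; eauto. Qed.

Lemma simplifies_to_mono (S S' : trs) e x :
  incl_trs S S' -> simplifies_to S e x -> simplifies_to S' e x.
Proof.
  intros H (x' & Hx & Hx'). exists x'. split; auto. clear Hx'.
  induction Hx as [|e1 e2 e3 (a & b & u & He & Hu & ->) _ IH]; [constructor|].
  apply (Relation_Operators.rt1n_trans _ _ _ (u, b)); auto. exists a, b, u. repeat split; auto.
  now apply rstep_mod_mono with S.
Qed.

Lemma reduces_trans_steps (S : trs) a b c :
  reduces S a b -> rt (rstep_mod B S) b c -> reduces S a c.
Proof.
  intros (x & y & Hx & Hxy & Hy) H. exists x, y. repeat split; auto.
  now apply rt_trans with b.
Qed.

Lemma reduces_sim (S : trs) a b c : simB B a b -> reduces S b c -> reduces S a c.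
Proof.
  intros H (x & y & Hx & Hxy & Hy). exists x, y. repeat split; auto.
  now apply simB_trans with b.
Qed.

Lemma reduces_steps (S : trs) a b : reduces S a b -> rt (rstep_mod B S) a b.
Proof.
  intros (x & y & Hx & Hxy & Hy). apply rt_trans with y; auto. apply rt_step.
  exists x. split; auto. exists y. split; auto. apply simB_refl.
Qed.

Lemma reduces_ctx (S : trs) : ctx_closed (reduces S).
Proof.
  intros C a b (x & y & Hx & Hxy & Hy). exists (fill C x), (fill C y). repeat split.
  - now apply simB_ctx.
  - now apply rstep_ctx.
  - apply rt_ctx; auto. apply rstep_mod_ctx.
Qed.

Lemma reduces_sub (S : trs) : sub_closed (reduces S).
Proof.
  intros s a b (x & y & Hx & Hxy & Hy). exists (tsub s x), (tsub s y). repeat split.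
  - now apply simB_sub.
  - now apply rstep_sub.
  - apply rt_sub; auto. apply rstep_mod_sub.
Qed.

Lemma rstep_reduces (S T : trs) a b :
  (forall l r, S (l, r) -> reduces T l r) -> rstep S a b -> reduces T a b.
Proof. intros H. apply rstep_incl_closed; auto using reduces_ctx, reduces_sub. Qed.

(* The trailing equivalence is absorbed by the last step. *)
Lemma steps_mod_sim (S : trs) a b c : rt (rstep_mod B S) a b -> simB B b c ->
  a = b \/ rt (rstep_mod B S) a c.
Proof.
  intros H Hbc. apply clos_rt_rtn1 in H. destruct H as [|b c' (x & Hx & y & Hxy & Hy) H]; auto.
  right. apply clos_rtn1_rt in H. apply rt_trans with b; auto. apply rt_step.
  exists x. split; auto. exists y. split; auto. now apply simB_trans with c'.
Qed.

Lemma rstep_mod_steps (S T : trs) a b :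
  (forall l r, S (l, r) -> reduces T l r) -> rstep_mod B S a b -> rt (rstep_mod B T) a b.
Proof.
  intros H (x & Hx & y & Hxy & Hy).
  apply rstep_reduces with (T := T) in Hxy; auto.
  apply reduces_sim with (a := a) in Hxy; auto.
  destruct Hxy as (x1 & c & Hx1 & Hc & Hcy).
  destruct (steps_mod_sim _ _ _ _ Hcy Hy) as [->|Hcb].
  (* Nothing follows the first step, which then absorbs the trailing equivalence itself. *)
  - apply rt_step. exists x1. split; auto. exists y. auto.
  - apply rt_trans with c; auto. apply rt_step. exists x1. split; auto. exists c.
    split; auto. apply simB_refl.
Qed.

Lemma simplifies_swap (S : trs) e e' : simplifies S (swap e) e' <-> simplifies S e e'.
Proof.
  assert (H : forall d0 : term * term, simplifies S d0 e' -> simplifies S (swap d0) e').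
  { intros d0 (a & b & u & Hd & Hu & ->). exists a, b, u. repeat split; auto.
    destruct Hd as [->| ->]; simpl; auto. }
  split; auto. intros H'. apply H in H'. now rewrite swap_swap in H'.
Qed.

Lemma simplifies_to_refl (S : trs) e : simplifies_to S e e.
Proof. exists e. split; auto. constructor. Qed.

Lemma simplifies_to_swap (S : trs) e : simplifies_to S e (swap e).
Proof. exists e. split; [constructor|]. rewrite swap_swap. auto. Qed.

Lemma simplifies_to_trans (S : trs) e x y :
  simplifies_to S e x -> simplifies_to S x y -> simplifies_to S e y.
Proof.
  intros (x' & Hx & Hx') (y' & Hy & Hy').
  destruct Hx' as [->| ->].
  - exists y'. split; auto. apply clos_rt_rt1n.
    apply rt_trans with x; now apply clos_rt1n_rt.
  - inversion Hy as [|z ? Hz Hzy]; subst.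
    + exists (swap y'). split; auto. destruct Hy' as [->| ->]; auto. rewrite swap_swap. auto.
    + exists y'. split; auto. apply clos_rt_rt1n. apply rt_trans with (swap x).
      * now apply clos_rt1n_rt.
      * apply rt_trans with z; [|now apply clos_rt1n_rt].
        apply rt_step. now apply simplifies_swap.
Qed.

Lemma simplifies_to_left (S : trs) a b u :
  rt (rstep_mod B S) a u -> simplifies_to S (a, b) (u, b).
Proof.
  intros H. apply clos_rt_rt1n in H.
  induction H as [a|a c u H _ IH]; [apply simplifies_to_refl|].
  apply simplifies_to_trans with (c, b); auto. exists (c, b). split; auto.
  apply (Relation_Operators.rt1n_trans _ _ _ (c, b)); [|constructor]. exists a, b, c. auto.
Qed.

Lemma simplifies_to_both (S : trs) a b u v :
  rt (rstep_mod B S) a u -> rt (rstep_mod B S) b v -> simplifies_to S (a, b) (u, v).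
Proof.
  intros Ha Hb. apply simplifies_to_trans with (u, b); [now apply simplifies_to_left|].
  apply simplifies_to_trans with (b, u); [apply (simplifies_to_swap S (u, b))|].
  apply simplifies_to_trans with (v, u); [now apply simplifies_to_left|].
  apply (simplifies_to_swap S (v, u)).
Qed.

Lemma peak_of_swap (S : trs) e : peak_of S e -> peak_of S (swap e).
Proof. intros (v & H1 & H2). now exists v. Qed.

(** Simplifying an equation only extends the tail of one of the two reductions from the common
    source. *)
Lemma peak_of_simplifies_to (S : trs) e x : simplifies_to S e x -> peak_of S e -> peak_of S x.
Proof.
  intros (x' & Hx & Hx') He.
  assert (H : peak_of S x').
  { clear Hx'. induction Hx as [|e1 e2 e3 (a & b & u & Hab & Hu & ->) _ IH]; auto.
    apply IH. assert (H : peak_of S (a, b)).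
    { destruct Hab as [->| ->]; auto. now apply peak_of_swap in He. }
    destruct H as (v & H1 & H2). exists v. split; auto.
    apply reduces_trans_steps with a; auto. now apply rt_step. }
  destruct Hx' as [->| ->]; auto. apply peak_of_swap in H. now rewrite swap_swap in H.
Qed.

(** * Simplification and orientation in sets of equations *)

Definition without (S : trs) (e : term * term) : trs := fun p => S p /\ p <> e.
Definition with_eq (S : trs) (e : term * term) : trs := fun p => S p \/ p = e.

Lemma without_dadd (S : trs) e : S e -> is_dadd (without S e) e S.
Proof.
  intros He. split; [intros [_ H]; auto|]. intros p. split.
  - intros Hp. destruct (classic (p = e)); [auto|left; split; auto].
  - intros [[Hp _]| ->]; auto.
Qed.

Lemma simplify_step (S E0 E1 : trs) e e' : is_dadd E0 e E1 -> simplifies S e e' ->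
  KBAC_step ac gt (E1, S) (with_eq E0 e', S).
Proof.
  intros Hd (a & b & u & He & Hu & ->). simpl. do 3 right. left.
  exists E0, a, b, u. repeat split; auto.
  destruct He as [->| ->]; auto.
Qed.

Lemma with_eq_dadd (S : trs) e : ~ S e -> is_dadd S e (with_eq S e).
Proof. intros H. split; auto. intros p. reflexivity. Qed.

(* Equations form sets, so simplifying [e0] to [ek] may run into a member [ej] of [E] on the way
   and would lose a copy of it.  Simplifying the last such [ej] instead, the target is reached at
   the cost of one member and without further collisions. *)
Lemma simplify_last_collision (S E : trs) e0 ek :
  clos_refl_trans_1n _ (simplifies S) e0 ek ->
  (exists ej E', simplifies_to S e0 ej /\ simplifies_to S ej ek /\ E ej /\
     is_dadd (without E ej) ek E' /\ KB_steps (E, S) (E', S)) \/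
  (~ E e0 /\ forall D : trs, incl_trs D E -> exists E',
     is_dadd D ek E' /\ KB_steps (with_eq D e0, S) (E', S)).
Proof.
  intros H. induction H as [e|e0 e1 ek H01 H1k IH].
  - destruct (classic (E e)) as [He|He].
    + left. exists e, E. repeat split; auto using simplifies_to_refl, KB_steps_refl.
      * intros [_ Hn]. auto.
      * intros Hp. now apply without_dadd.
      * intros Hp. now apply (without_dadd E e).
    + right. split; auto. intros D HD. exists (with_eq D e). split; [|apply KB_steps_refl].
      apply with_eq_dadd. auto.
  - assert (S01 : simplifies_to S e0 e1).
    { exists e1. split; auto. apply (Relation_Operators.rt1n_trans _ _ _ e1); [auto|constructor]. }
    destruct IH as [(ej & E' & H1 & H2 & H3 & H4 & H5)|[H1 H2]].
    + left. exists ej, E'. repeat split; auto; try apply H4.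
      now apply simplifies_to_trans with e1.
    + destruct (classic (E e0)) as [He|He].
      (* The path from [e1] on is free of collisions, so [e0] is the last one; [D] is instantiated
         with the other members of [E]. *)
      * left. destruct (H2 (without E e0)) as (E' & H3 & H4); [now intros p [Hp _]|].
        exists e0, E'. split; [apply simplifies_to_refl|]. split; [|split; [auto|split; [auto|]]].
        -- apply simplifies_to_trans with e1; auto. exists ek. auto.
        -- eapply KB_steps_trans; [|exact H4]. apply KB_steps_one.
           apply simplify_step with e0; auto. now apply without_dadd.
      * right. split; auto. intros D HD. destruct (H2 D HD) as (E' & H3 & H4).
        exists E'. split; auto. eapply KB_steps_trans; [|exact H4]. apply KB_steps_one.
        apply simplify_step with e0; auto. apply with_eq_dadd. auto.
Qed.

(** The equation consumed is the last collision [ej], not necessarily [e0]. Both halves of the path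
    through [ej] are returned so that [e0] can stand in for it afterwards. *)
Lemma orient_equation (S E : trs) e0 a b : E e0 -> simplifies_to S e0 (a, b) -> gt a b ->
  exists ej, simplifies_to S e0 ej /\ simplifies_to S ej (a, b) /\ E ej /\
    KB_steps (E, S) (without E ej, with_eq S (a, b)).
Proof.
  intros He (x & Hx & Hxab) Hab.
  destruct (simplify_last_collision S E e0 x Hx)
    as [(ej & E' & H1 & H2 & H3 & H4 & H5)|[H _]]; [|contradiction].
  exists ej. split; [auto|]. split; [|split; [auto|]].
  - apply simplifies_to_trans with x; auto.
    destruct Hxab as [->| ->]; [apply simplifies_to_refl|apply (simplifies_to_swap S (b, a))].
  - eapply KB_steps_trans; [exact H5|]. apply KB_steps_one. simpl. right. left.
    exists (without E ej), a, b. split; [|split; [auto|split; now intros p]].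
    destruct Hxab as [->| ->]; [left|right]; exact H4.
Qed.

(** The first reducts satisfy [c1 <- x1 ~ x2 -> c2], as Deduce asks; the tails of the two reductions
    are then simplifications. *)
Lemma deduce_peak (S E : trs) e : peak_of S e -> exists e0,
  simplifies_to S e0 e /\ peak_of S e0 /\ KBAC_step ac gt (E, S) (with_eq E e0, S).
Proof.
  intros (v & (x1 & c1 & H1 & H1' & H1'') & (x2 & c2 & H2 & H2' & H2'')).
  exists (c1, c2). destruct e as [a b]. simpl in *. split; [|split].
  - now apply simplifies_to_both.
  - exists v. split; [exists x1, c1|exists x2, c2]; repeat split; auto; apply rt_refl.
  - left. exists c1, c2. split; [|repeat split; auto].
    exists x1. split; auto. exists x2. split; auto.
    apply simB_trans with v; auto using simB_sym.
Qed.

(* Equations of an [I_A] state are either available as peaks at any time, or owe their existence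
   to an equation [e] of the [KB] state, which is kept unsimplified until the [I_A] run orients
   its descendant. *)
Definition owned (E E' S' : trs) (M : term * term -> term * term -> Prop) : Prop :=
  (forall x e, M x e -> E x /\ E' e /\ simplifies_to S' e x) /\
  (forall x y e, M x e -> M y e -> x = y) /\
  (forall x, E x -> peak_of S' x \/ exists e, M x e).

Definition simulated (st st' : trs * trs) : Prop :=
  (forall l r, snd st (l, r) -> reduces (snd st') l r) /\
  oriented gt (snd st') /\
  exists M, owned (fst st) (fst st') (snd st') M.

(** Serves inferences to which the [KB] run does not respond; the owner of a vanished equation
    simply owns nothing from then on. *)
Lemma simulated_weaken E E1 S S1 E' S' : simulated (E, S) (E', S') ->
  (forall l r, S1 (l, r) -> reduces S' l r) ->
  (forall x, E1 x -> E x \/ peak_of S' x) -> simulated (E1, S1) (E', S').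
Proof.
  intros (_ & HO & M & HM1 & HM2 & HM3) HS HE. split; [auto|split; auto].
  exists (fun x e => E1 x /\ M x e). split; [|split].
  - intros x e [Hx H]. split; auto. now apply HM1.
  - intros x y e [_ H1] [_ H2]. eauto.
  - intros x Hx. destruct (HE x Hx) as [H|H]; auto. destruct (HM3 x H) as [H'|[e He]]; eauto.
Qed.

Lemma simulate_orient E0 x E S S1 E1 E' S' a b : simulated (E, S) (E', S') ->
  is_dadd E0 x E -> x = (a, b) \/ x = (b, a) -> gt a b ->
  same E1 E0 -> is_add S (a, b) S1 ->
  exists st, KB_steps (E', S') st /\ simulated (E1, S1) st.
Proof.
  intros (HS & HO & M & HM1 & HM2 & HM3) [Hx0 Hd] Hx Hab HE1 HS1. simpl in *.
  set (S'' := with_eq S' (a, b)).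
  assert (Hmono : incl_trs S' S'') by (intros p Hp; now left).
  assert (Hrules : forall l r, S1 (l, r) -> reduces S'' l r).
  { intros l r H. apply HS1 in H as [H|H]; [apply reduces_mono with S'; auto|].
    injection H as -> ->. exists a, b. split; [apply simB_refl|split; [|apply rt_refl]].
    apply rstep_rule. now right. }
  assert (Hor : oriented gt S'').
  { intros l r [H|H]; auto. now injection H as -> ->. }
  assert (Hxab : simplifies_to S' x (a, b)).
  { destruct Hx as [->| ->]; [apply simplifies_to_refl|apply (simplifies_to_swap S' (b, a))]. }
  assert (HEx : E x) by (apply Hd; auto).
  assert (HE0 : forall y, E1 y -> E0 y /\ E y /\ y <> x).
  { intros y Hy. apply HE1 in Hy. split; [auto|split; [apply Hd; auto|]]. congruence. }
  destruct (HM3 x HEx) as [Hp|[e0 He0]].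
  (* Here [x] is a peak: an ancestor [e0] of it is deduced afresh for the orientation. *)
  - destruct (deduce_peak S' E' x Hp) as (e0 & H1 & H2 & H3).
    destruct (orient_equation S' (with_eq E' e0) e0 a b) as (ej & J1 & J2 & J3 & J4); auto.
    { now right. }
    { now apply simplifies_to_trans with x. }
    exists (without (with_eq E' e0) ej, S''). split.
    { eapply KB_steps_trans; [apply KB_steps_one, H3|exact J4]. }
    split; [auto|split; [auto|]]. simpl.
    exists (fun y e => E1 y /\ M y e /\ e <> ej). split; [|split].
    + intros y e (Hy & Hye & Hne). destruct (HM1 _ _ Hye) as (_ & K1 & K2).
      repeat split; auto; [now left|]. now apply simplifies_to_mono with S'.
    + intros y z e (_ & Hy & _) (_ & Hz & _). eauto.
    + intros y Hy. destruct (HE0 y Hy) as (_ & HEy & _).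
      destruct (HM3 y HEy) as [Hpy|[e He]]; [left; now apply peak_of_mono with S'|].
      destruct (classic (e = ej)) as [->|Hne]; [|right; exists e; auto].
      (* Whatever the consumed [ej] owned is a peak, because the deduced peak [e0] simplifies to
         [ej]. *)
      left. apply peak_of_mono with S'; auto. apply peak_of_simplifies_to with e0; auto.
      apply simplifies_to_trans with ej; auto. now apply HM1.
  - destruct (HM1 _ _ He0) as (_ & K1 & K2).
    destruct (orient_equation S' E' e0 a b) as (ej & J1 & J2 & J3 & J4); auto.
    { now apply simplifies_to_trans with x. }
    exists (without E' ej, S''). split; [exact J4|].
    split; [auto|split; [auto|]]. simpl.
    (* [e0] owned only [x], which has just been oriented, so it is free to own something else. *)
    assert (Hfree : forall y, E1 y -> ~ M y e0).
    { intros y Hy H. apply (HE0 y Hy). eauto. }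
    (* [e0] simplifies to [ej], so it takes over from the consumed [ej] *)
    exists (fun y e => E1 y /\ ((M y e /\ e <> ej) \/ (M y ej /\ e = e0))). split; [|split].
    + intros y e (Hy & [[Hye Hne]|[Hye ->]]); (split; [auto|split]).
      * split; auto. now apply HM1 in Hye.
      * apply simplifies_to_mono with S'; auto. now apply HM1.
      * split; auto. intros ->. now apply (Hfree y).
      * apply simplifies_to_mono with S'; auto. apply simplifies_to_trans with ej; auto.
        now apply HM1.
    + intros y z e (Hy & [[Hye Hne]|[Hye ->]]) (Hz & [[Hze Hne']|[Hze He]]); subst; eauto.
      * destruct (Hfree y Hy Hye).
      * destruct (Hfree z Hz Hze).
    + intros y Hy. destruct (HE0 y Hy) as (_ & HEy & _).
      destruct (HM3 y HEy) as [Hpy|[e He]]; [left; now apply peak_of_mono with S'|].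
      right. destruct (classic (e = ej)) as [->|Hne]; [exists e0|exists e]; auto.
Qed.

Lemma simulate_simplify E0 x E S S1 E1 E' S' a b u : simulated (E, S) (E', S') ->
  is_dadd E0 x E -> x = (a, b) \/ x = (b, a) -> rstep_mod B S a u ->
  is_add E0 (u, b) E1 -> same S1 S -> simulated (E1, S1) (E', S').
Proof.
  intros (HS & HO & M & HM1 & HM2 & HM3) [Hx0 Hd] Hx Hu HE1 HS1. simpl in *.
  split; [|split; auto]; simpl.
  { intros l r H. apply HS. now apply HS1. }
  assert (Hau : rt (rstep_mod B S') a u) by now apply rstep_mod_steps with S.
  assert (Hxu : simplifies_to S' x (u, b)).
  { apply simplifies_to_trans with (a, b); [|now apply simplifies_to_left].
    destruct Hx as [->| ->]; [apply simplifies_to_refl|apply (simplifies_to_swap S' (b, a))]. }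
  (* The owner of [x] now owns [(u, b)]. If that equation was already present, the two merge and the
     owner of [x] is left with nothing. *)
  exists (fun y e => (E0 y /\ M y e) \/ (~ E0 (u, b) /\ y = (u, b) /\ M x e)).
  split; [|split].
  - intros y e [[Hy Hye]|(Hn & -> & Hxe)].
    + destruct (HM1 _ _ Hye) as (_ & K1 & K2). split; [apply HE1|]; auto.
    + destruct (HM1 _ _ Hxe) as (_ & K1 & K2). split; [apply HE1; auto|split; auto].
      now apply simplifies_to_trans with x.
  - intros y z e [[Hy Hye]|(Hn & -> & Hye)] [[Hz Hze]|(Hn' & -> & Hze)]; eauto.
    + assert (y = x) by eauto. subst. contradiction.
    + assert (z = x) by eauto. subst. contradiction.
  - intros y Hy. apply HE1 in Hy.
    destruct (classic (E0 y)) as [Hy0|Hy0].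
    + destruct (HM3 y) as [H|[e He]]; [apply Hd| |right; exists e]; auto.
    + destruct Hy as [Hy| ->]; [contradiction|].
      destruct (HM3 x) as [H|[e He]]; [apply Hd; auto| |right; exists e; auto].
      left. now apply peak_of_simplifies_to with x.
Qed.

(** The [KB] run moves only on Orient. Since no rule leaves [S'], the equation produced by
    collapsing [a -> b] is a peak with source [a], and a composed rule is a longer reduction. *)
Lemma simulate_step st st1 st' : IA_step B gt st st1 -> simulated st st' ->
  exists st1', KB_steps st' st1' /\ simulated st1 st1'.
Proof.
  destruct st as [E S], st1 as [E1 S1], st' as [E' S']. simpl. intros Hst Hsim.
  pose proof (proj1 Hsim) as HS. simpl in HS.
  assert (Hstep : forall (T : trs) x y, incl_trs T S -> rstep T x y -> reduces S' x y).
  { intros T x y HT. apply rstep_reduces. auto. }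
  destruct Hst as [(a & b & (v & Hva & Hvb) & HE & HS1)|[(a & b & (v & Hva & Hvb) & HE & HS1)|
    [(E0 & a & b & Hd & Hab & HE & HS1)|[(E0 & a & b & Hd & Hab & HE & HS1)|
    [(E0 & a & b & u & Hd & Hu & HE & HS1)|[(S0 & a & b & u & Hd & Hu & HE & HS1)|
    (S0 & a & b & u & Hd & Hu & HE & HS1)]]]]]].
  - exists (E', S'). split; [apply KB_steps_refl|].
    apply simulated_weaken with E S; auto.
    + intros l r H. apply HS. now apply HS1.
    + intros x Hx. apply HE in Hx as [Hx| ->]; auto. right. exists v.
      split; apply (Hstep S); auto; now intros p.
  - exists (E', S'). split; [apply KB_steps_refl|].
    apply simulated_weaken with E S; auto.
    + intros l r H. apply HS1 in H as [H|H]; auto. injection H as -> ->.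
      apply reduces_sim with v.
      * apply simB_sym. now apply rt_step.
      * apply (Hstep S); auto. now intros p.
    + intros x Hx. apply HE in Hx. auto.
  - destruct Hd as [Hd|Hd].
    + apply simulate_orient with E0 (a, b) E S a b; auto.
    + apply simulate_orient with E0 (b, a) E S a b; auto.
  - exists (E', S'). split; [apply KB_steps_refl|].
    apply simulated_weaken with E S; auto.
    + intros l r H. apply HS. now apply HS1.
    + intros x Hx. apply HE in Hx. left. apply Hd. auto.
  - exists (E', S'). split; [apply KB_steps_refl|].
    destruct Hd as [Hd|Hd].
    + apply simulate_simplify with E0 (a, b) E S a b u; auto.
    + apply simulate_simplify with E0 (b, a) E S a b u; auto.
  - assert (Hincl : incl_trs S0 S) by (intros p Hp; apply Hd; auto).
    exists (E', S'). split; [apply KB_steps_refl|].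
    apply simulated_weaken with E S; auto.
    + intros l r H. apply HS, Hincl, HS1, H.
    + intros x Hx. apply HE in Hx as [Hx| ->]; auto. right. exists a. simpl. split.
      * now apply (Hstep S0).
      * apply HS, Hd. auto.
  - assert (Hincl : incl_trs S0 S) by (intros p Hp; apply Hd; auto).
    exists (E', S'). split; [apply KB_steps_refl|].
    apply simulated_weaken with E S; auto.
    + intros l r H. apply HS1 in H as [H|H]; [now apply HS, Hincl|]. injection H as -> ->.
      apply reduces_trans_steps with b; [apply HS, Hd; auto|].
      apply rstep_mod_steps with S0; auto.
    + intros x Hx. apply HE in Hx. auto.
Qed.

Lemma simulate_run (E : trs) n sq : is_run (IA_step B gt) E n sq ->
  forall i, i <= n -> exists st, KB_steps (sq 0) st /\ simulated (sq i) st.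
Proof.
  intros (HE & HS & Hstep). induction i as [|i IH]; intros Hi.
  - exists (sq 0). split; [apply KB_steps_refl|]. split; [|split].
    + intros l r H. apply HS in H. destruct H.
    + intros l r H. apply HS in H. destruct H.
    + exists (fun x e => fst (sq 0) x /\ x = e). split; [|split].
      * intros x e [Hx <-]. auto using simplifies_to_refl.
      * intros x y e [_ ->] [_ ->]. auto.
      * intros x Hx. eauto.
  - destruct IH as (st & H1 & H2); [lia|].
    destruct (simulate_step (sq i) (sq (S i)) st) as (st' & H3 & H4); auto.
    exists st'. split; auto. eapply KB_steps_trans; eauto.
Qed.

(** * Removing the remaining equations *)

Definition joinable_mod (S : trs) (e : term * term) : Prop :=
  exists u v, rt (rstep_mod B S) (fst e) u /\ simB B u v /\ rt (rstep_mod B S) (snd e) v.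

(** Merging is harmless at this stage: it can only make further equations disappear. *)
Lemma delete_joinable (S E : trs) e : E e -> joinable_mod S e ->
  exists E', KB_steps (E, S) (E', S) /\ incl_trs E' (without E e).
Proof.
  intros He (u & v & Hu & Huv & Hv).
  destruct (simplifies_to_both S (fst e) (snd e) u v Hu Hv) as (x & Hx & Hxuv).
  rewrite <- surjective_pairing in Hx.
  assert (Hsim : simB B (fst x) (snd x)).
  { destruct Hxuv as [->| ->]; simpl; auto using simB_sym. }
  assert (Hpath : exists E1, KB_steps (E, S) (E1, S) /\ E1 x /\
    forall p, E1 p -> without E e p \/ p = x).
  { assert (H : forall p, E p -> without E e p \/ p = e).
    { intros p Hp. destruct (classic (p = e)); [auto|left; split; auto]. }
    (* A fixed [D] bounds everything except the equation being simplified, whatever merges occur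
       along the path. *)
    revert H. generalize (without E e). intros D. revert E He. clear Hu Hv Hxuv.
    induction Hx as [x|e0 e1 x H01 _ IH]; intros E He HD.
    - exists E. split; [apply KB_steps_refl|auto].
    - destruct (IH Hsim (with_eq (without E e0) e1)) as (E1 & K1 & K2 & K3).
      + now right.
      + intros p [[Hp Hne]|Hp]; auto. destruct (HD p Hp); [auto|contradiction].
      + exists E1. split; [|auto]. eapply KB_steps_trans; [|exact K1]. apply KB_steps_one.
        apply simplify_step with e0; auto. now apply without_dadd. }
  destruct Hpath as (E1 & K1 & K2 & K3).
  exists (without E1 x). split.
  - eapply KB_steps_trans; [exact K1|]. apply KB_steps_one. simpl. right. right. left.
    exists (without E1 x), (fst x), (snd x). rewrite <- surjective_pairing.
    split; [now apply without_dadd|split; [auto|split; now intros p]].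
  - intros p [Hp Hne]. destruct (K3 p Hp); [auto|contradiction].
Qed.

Lemma delete_all (S E : trs) : finite E -> (forall e, E e -> joinable_mod S e) ->
  exists E', KB_steps (E, S) (E', S) /\ same E' (@empty_trs F).
Proof.
  intros [L HL]. revert E HL. induction L as [|e L IH]; intros E HL HJ.
  - exists E. split; [apply KB_steps_refl|]. intros p. split; [apply HL|intros []].
  - destruct (classic (E e)) as [He|He].
    + destruct (delete_joinable S E e He (HJ e He)) as (E1 & K1 & K2).
      destruct (IH E1) as (E2 & K3 & K4).
      * intros p Hp. apply K2 in Hp as [Hp Hne]. destruct (HL p Hp); [congruence|auto].
      * intros p Hp. apply HJ. apply K2 in Hp. apply Hp.
      * exists E2. split; auto. eapply KB_steps_trans; eauto.
    + apply IH; auto. intros p Hp. destruct (HL p Hp) as [<-|]; [contradiction|auto].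
Qed.

Lemma terminating_mod_oriented (S : trs) : oriented gt S -> terminating_mod B S.
Proof.
  intros HO [f Hf].
  assert (H : forall a i, a = f i -> False).
  { intros a. induction a as [a IH] using (well_founded_induction (gt_wf gt B Hgt)).
    intros i ->. apply (IH (f (Datatypes.S i))) with (Datatypes.S i); auto.
    now apply (rstep_mod_gt gt B Hgt S). }
  exact (H _ 0 eq_refl).
Qed.

End Simulation.

Lemma ACeqs_linear (ac : F -> Prop) l r : ACeqs ac (l, r) ->
  NoDup (vars l) /\ NoDup (vars r) /\ forall x, In x (vars l) <-> In x (vars r).
Proof.
  intros (f & _ & [H|H]); injection H as -> ->; simpl;
    (split; [|split]); try (intros x; tauto);
    repeat constructor; simpl; intuition discriminate.
Qed.

End Development.

Theorem theorem7p5 (F : Type) (ac : F -> Prop) (gt : rel F)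
  (Hgt : B_compatible_reduction_order (ACeqs ac) gt)
  (E : trs F) (n : nat) (sq : nat -> trs F * trs F) :
  is_run (IA_step (ACeqs ac) gt) E n sq ->
  fair_run (ACeqs ac) n sq ->
  same (fst (sq n)) (@empty_trs F) ->
  exists (m : nat) (sq' : nat -> trs F * trs F),
    is_run (KBAC_step ac gt) E m sq' /\
    same (fst (sq' m)) (@empty_trs F) /\
    AC_complete_presentation ac (snd (sq' m)) E.
Proof.
  intros Hrun Hfair Hempty.
  pose proof (fair_run_church_rosser F gt (ACeqs ac) Hgt (ACeqs_linear F ac) E n sq
    Hrun Hfair Hempty) as Hcr.
  destruct (simulate_run F gt ac E n sq Hrun n (le_n _)) as ([E1 R] & Hsteps & HR & HO & _).
  simpl in HR, HO. destruct Hrun as (HE & HS & Hstep).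
  assert (Hjoin : forall a b, conv (Defs.union E (ACeqs ac)) a b ->
    exists u v, rt (rstep_mod (ACeqs ac) R) a u /\ simB (ACeqs ac) u v /\
      rt (rstep_mod (ACeqs ac) R) b v).
  { intros a b Hab. destruct (Hcr a b Hab) as (u & v & Hu & Huv & Hv).
    assert (Hmap : forall x y, rt (rstep (snd (sq n))) x y -> rt (rstep_mod (ACeqs ac) R) x y).
    { intros x y. apply rt_incl. intros x' y' H.
      now apply reduces_steps, rstep_reduces with (S := snd (sq n)). }
    exists u, v. auto. }
  assert (Hsound : forall st, KB_steps F gt ac (sq 0) st -> sound F ac E st).
  { intros st H. apply KB_steps_sound with gt (sq 0); auto. intros l r [H0|H0].
    - rewrite HE in H0. apply rt_step. left. apply rstep_union. left. now apply rstep_rule.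
    - apply HS in H0. destruct H0. }
  assert (Hfin : finite F (fst (sq 0))).
  { assert (H : forall k, k <= n -> finite F (fst (sq (n - k)))).
    { induction k as [|k IH]; intros Hk.
      - rewrite Nat.sub_0_r. exists []. intros p Hp. now apply Hempty in Hp.
      - apply IA_step_finite with gt ac (sq (S (n - S k))); [apply Hstep; lia|].
        replace (S (n - S k)) with (n - k) by lia. apply IH. lia. }
    rewrite <- (Nat.sub_diag n). apply H, le_n. }
  destruct (delete_all F gt ac R E1) as (E2 & Hsteps2 & HE2).
  { now apply (KB_steps_finite F gt ac _ _ Hsteps). }
  (* A remaining equation is a conversion over [E] and AC by soundness, hence joinable by [R] modulo
     AC. *)
  { intros [a b] He. apply Hjoin. apply (Hsound _ Hsteps). now left. }
  pose proof (KB_steps_trans F gt ac _ _ _ Hsteps Hsteps2) as Hall.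
  destruct (KB_steps_run F gt ac _ _ Hall) as (m & sq' & H0 & Hm & Hsq).
  exists m, sq'. rewrite Hm. simpl.
  assert (Hback : forall a b, conv (Defs.union R (ACeqs ac)) a b ->
    conv (Defs.union E (ACeqs ac)) a b).
  { intros a b. apply rt_incl.
    assert (H1 : forall x y, rstep (Defs.union R (ACeqs ac)) x y ->
      conv (Defs.union E (ACeqs ac)) x y).
    { intros x y. apply conv_of_rstep. intros l r [H|H].
      - apply (Hsound _ Hsteps). now right.
      - apply conv_union_sim, rt_step. left. now apply rstep_rule. }
    intros x y [H|H]; [|apply conv_sym]; now apply H1. }
  split; [|split; [exact HE2|split; [|split]]].
  - split; [now rewrite H0|split; [now rewrite H0|exact Hsq]].
  - now apply terminating_mod_oriented with gt.
  - intros a b. split; [|apply Hback]. intros Hab.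
    destruct (Hjoin a b Hab) as (u & v & Hu & Huv & Hv).
    assert (Hconv : forall x y, rt (rstep_mod (ACeqs ac) R) x y ->
      conv (Defs.union R (ACeqs ac)) x y).
    { intros x y. apply rt_incl. intros x' y'. apply conv_of_rstep_mod. intros l r H.
      apply rt_step. left. apply rstep_union. left. now apply rstep_rule. }
    apply rt_trans with u; [now apply Hconv|].
    apply rt_trans with v; [exact (conv_union_sim F R (ACeqs ac) u v Huv)|].
    apply conv_sym. auto.
  - intros a b Hab. apply Hjoin. auto.
Qed.
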